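(* Let $d\ge1$ and let $P$ be the algebra of operators on $\mathscr{F}_+$ generated by $e_i,f_i$ $(1\le i\le d)$ and $K$, with basis $\Omega=\{(\prod_{i=1}^de_i^{m_i}f_i^{n_i})K^\ell\mid m_i,n_i,\ell\in\{0,1\}\}$. Define the linear function $\varphi:P\to\mathbb{C}$ by $$\varphi\Bigl(\bigl(\textstyle\prod_{i=1}^de_i^{m_i}f_i^{n_i}\bigr)K^\ell\Bigr)=\delta_{\ell,1}\prod_{i=1}^d\delta_{m_i,1}\delta_{n_i,1}.$$ Then $P$ is a symmetric algebra with $\varphi$; that is, $\varphi$ is symmetric ($\varphi(xy)=\varphi(yx)$ for all $x,y\in P$) and the bilinear form $P\times P\to\mathbb{C}$, $(x,y)\mapsto\varphi(xy)$, is non-degenerate.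
   Context: Let $\mathfrak{h}$ be a $2d$-dimensional complex vector space with a non-degenerate skew-symmetric form $\langle\,,\rangle$ and a basis $\{\phi^i,\psi^i\}_{i=1}^d$ with $\langle\phi^i,\phi^j\rangle=\langle\psi^i,\psi^j\rangle=0$, $\langle\phi^i,\psi^j\rangle=-\langle\psi^j,\phi^i\rangle=-\delta_{ij}$. Let $\mathscr{A}$ be the associative unital superalgebra generated by odd elements $h_n$ ($h\in\mathfrak{h}$, $n\in\mathbb{Z}$), linear in $h$, with relations $h_mh'_n+h'_nh_m=m\langle h,h'\rangle\delta_{m+n,0}$. Let $\mathscr{F}_+=\mathscr{A}/\mathscr{A}_+$, where $\mathscr{A}_+$ is the left ideal generated by all $h_n$ with $n>0$, and let $|0\rangle_+$ be the image of $1$. $\mathscr{F}_+$ is spanned by $h^1_{-n_1}\cdots h^r_{-n_r}|0\rangle_+$ with $n_j\ge0$; its even part $\mathscr{F}_+^+$ (odd part $\mathscr{F}_+^-$) is spanned by those with $r$ even (odd). On $\mathscr{F}_+$ put $e_i=\phi^i_0$, $f_i=\psi^i_0$ (action of elements of $\mathscr{A}$), and let $K$ be the operator acting as $+1$ on $\mathscr{F}_+^+$ and $-1$ on $\mathscr{F}_+^-$. $P$ is the subalgebra of $\mathrm{End}_{\mathbb{C}}(\mathscr{F}_+)$ generated by all $e_i,f_i$ and $K$ (these operators commute with the action on $\mathscr{F}_+$ of $\mathscr{F}^+$, the even part of the symplectic fermionic vertex operator superalgebra, so $P\subset\mathrm{End}_{\mathscr{F}^+}(\mathscr{F}_+)$).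 The product $\prod_{i=1}^de_i^{m_i}f_i^{n_i}$ is ordered as $e_1^{m_1}f_1^{n_1}e_2^{m_2}f_2^{n_2}\cdots$; the set $\Omega$ is a basis of $P$. *)

(* Defs.v *)
From HB Require Import structures.
From mathcomp Require Import all_boot all_order all_algebra.
From mathcomp Require Import sesquilinear generic_quotient ring_quotient.
From mathcomp Require Import finmap boolp.
From mathcomp Require Import monalg.

Set Implicit Arguments.
Unset Strict Implicit.
Unset Printing Implicit Defensive.

Import GRing.Theory Num.Theory.
Local Open Scope ring_scope.
Local Open Scope quotient_scope.

Section Span.
Variables (K : fieldType) (V : lmodType K).

Inductive span (S : V -> Prop) : V -> Prop :=
| span_incl v : S v -> span S v
| span0 : span S 0
| span_lin a u v : span S u -> span S v -> span S (a *: u + v).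

Lemma span_scale (S : V -> Prop) a v : span S v -> span S (a *: v).
Proof.
by move=> Sv; rewrite -[a *: v]addr0; apply: span_lin => //; apply: span0.
Qed.

Definition span_pred (S : V -> Prop) : {pred V} := fun v => `[< span S v >].

Lemma span_predP S v : reflect (span S v) (v \in span_pred S).
Proof. exact: asboolP. Qed.

Lemma span_pred_zmod S : GRing.zmod_closed (span_pred S).
Proof.
split; first by apply/span_predP; apply: span0.
move=> u v /span_predP Su /span_predP Sv; apply/span_predP.
by rewrite -scaleN1r addrC; apply: span_lin.
Qed.

HB.instance Definition _ S :=
  GRing.isZmodClosed.Build V (span_pred S) (span_pred_zmod S).

End Span.

Lemma span_linear (K : fieldType) (V W : lmodType K) (f : {linear V -> W})
    (S : V -> Prop) (S' : W -> Prop) :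
  (forall v, S v -> span S' (f v)) -> forall v, span S v -> span S' (f v).
Proof.
move=> fS v; elim=> [{}v /fS //||a u {}v _ IHu _ IHv].
  by rewrite linear0; apply: span0.
by rewrite linearP; apply: span_lin.
Qed.

Section LmodQuotient.
Variables (K : fieldType) (V : lmodType K) (S : V -> Prop).

(* V modulo the submodule spanned by S *)
Definition lmod_quot : Type := Quotient.quot (span_pred S).

HB.instance Definition _ := GRing.Zmodule.on lmod_quot.

End LmodQuotient.

HB.lock Definition lmod_pi (K : fieldType) (V : lmodType K) (S : V -> Prop)
  (v : V) : lmod_quot S := \pi_(Quotient.quot (span_pred S)) v.
HB.lock Definition lmod_repr (K : fieldType) (V : lmodType K) (S : V -> Prop)
  (x : lmod_quot S) : V := repr (x : Quotient.quot (span_pred S)).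

Section LmodQuotientTheory.
Variables (K : fieldType) (V : lmodType K) (S : V -> Prop).
Local Notation lmod_quot := (lmod_quot S).
Local Notation lmod_pi := (lmod_pi S).

Lemma lmod_reprK : cancel (@lmod_repr _ _ S) lmod_pi.
Proof. by move=> x; rewrite lmod_pi.unlock lmod_repr.unlock; apply: reprK. Qed.

Lemma lmod_piP u v : lmod_pi u = lmod_pi v <-> span S (u - v).
Proof.
rewrite lmod_pi.unlock; split=> [/eqP|].
  by rewrite -Quotient.idealrBE => /span_predP.
by move=> uv; apply/eqP; rewrite -Quotient.idealrBE; apply/span_predP.
Qed.

Lemma lmod_piD : {morph lmod_pi : u v / u + v}.
Proof. by move=> u v; rewrite lmod_pi.unlock raddfD. Qed.

Lemma lmod_repr_pi v : span S (lmod_repr (lmod_pi v) - v).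
Proof. by apply/lmod_piP; rewrite lmod_reprK. Qed.

Definition lmod_quot_scale (a : K) (x : lmod_quot) : lmod_quot :=
  lmod_pi (a *: lmod_repr x).

Lemma lmod_piZ a v : lmod_pi (a *: v) = lmod_quot_scale a (lmod_pi v).
Proof.
apply/esym/lmod_piP; rewrite -scalerBr; apply: span_scale; exact: lmod_repr_pi.
Qed.

Lemma lmod_quot_scaleA a b x :
  lmod_quot_scale a (lmod_quot_scale b x) = lmod_quot_scale (a * b) x.
Proof. by rewrite -[x]lmod_reprK -!lmod_piZ scalerA. Qed.

Lemma lmod_quot_scale1 : left_id 1 lmod_quot_scale.
Proof. by move=> x; rewrite -[x]lmod_reprK -!lmod_piZ scale1r. Qed.

Lemma lmod_quot_scaleDr : right_distributive lmod_quot_scale +%R.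
Proof.
move=> a x y; rewrite -[x]lmod_reprK -[y]lmod_reprK.
by rewrite -lmod_piD -!lmod_piZ scalerDr lmod_piD.
Qed.

Lemma lmod_quot_scaleDl x : {morph lmod_quot_scale^~ x : a b / a + b}.
Proof.
by move=> a b; rewrite -[x]lmod_reprK -!lmod_piZ scalerDl lmod_piD.
Qed.

HB.instance Definition _ := GRing.Zmodule_isLmodule.Build K lmod_quot
  lmod_quot_scaleA lmod_quot_scale1 lmod_quot_scaleDr lmod_quot_scaleDl.

Lemma lmod_pi_is_linear : linear lmod_pi.
Proof. by move=> a u v; rewrite lmod_piD lmod_piZ. Qed.

HB.instance Definition _ :=
  GRing.isLinear.Build K V lmod_quot _ lmod_pi lmod_pi_is_linear.

End LmodQuotientTheory.

Lemma lmod_quot_lift (K : fieldType) (V W : lmodType K) (S : V -> Prop)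
    (f : {linear V -> W}) : (forall v, S v -> f v = 0) ->
  forall u v : V, lmod_pi S u = lmod_pi S v -> f u = f v.
Proof.
move=> fS u v /lmod_piP uv; apply/eqP; rewrite -subr_eq0 -linearB; apply/eqP.
elim: uv => [w /fS //||a x y _ fx _ fy]; first exact: linear0.
by rewrite linearP fx fy scaler0 addr0.
Qed.

(* The free algebra on I.  Its operations are those of the monoid algebra of
   the free monoid on I; they are locked to keep unification tractable. *)
Definition free_alg (K : fieldType) (I : choiceType) : Type :=
  {malg K[{fmonom I}]}.

HB.lock Definition free_zero (K : fieldType) (I : choiceType) : free_alg K I :=
  (0 : {malg K[{fmonom I}]}).
HB.lock Definition free_opp (K : fieldType) (I : choiceType)
  (x : free_alg K I) : free_alg K I := - (x : {malg K[{fmonom I}]}).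
HB.lock Definition free_add (K : fieldType) (I : choiceType)
  (x y : free_alg K I) : free_alg K I := (x : {malg K[{fmonom I}]}) + y.
HB.lock Definition free_one (K : fieldType) (I : choiceType) : free_alg K I :=
  (1 : {malg K[{fmonom I}]}).
HB.lock Definition free_mul (K : fieldType) (I : choiceType)
  (x y : free_alg K I) : free_alg K I := (x : {malg K[{fmonom I}]}) * y.
HB.lock Definition free_scale (K : fieldType) (I : choiceType)
  (a : K) (x : free_alg K I) : free_alg K I := a *: (x : {malg K[{fmonom I}]}).

Section FreeAlgebra.
Variables (K : fieldType) (I : choiceType).
Local Notation M := {malg K[{fmonom I}]}.
Local Notation T := (free_alg K I).

HB.instance Definition _ := Choice.copy T M.

Fact free_addA : associative (@free_add K I).
Proof. by rewrite free_add.unlock; apply: (@addrA M). Qed.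
Fact free_addC : commutative (@free_add K I).
Proof. by rewrite free_add.unlock; apply: (@addrC M). Qed.
Fact free_add0 : left_id (@free_zero K I) (@free_add K I).
Proof. by rewrite free_add.unlock free_zero.unlock; apply: (@add0r M). Qed.
Fact free_addN : left_inverse (@free_zero K I) (@free_opp K I) (@free_add K I).
Proof.
by rewrite free_add.unlock free_zero.unlock free_opp.unlock; apply: (@addNr M).
Qed.

HB.instance Definition _ :=
  GRing.isZmodule.Build T free_addA free_addC free_add0 free_addN.

Fact free_mulA : associative (@free_mul K I).
Proof. by rewrite free_mul.unlock; apply: (@mulrA M). Qed.
Fact free_mul1 : left_id (@free_one K I) (@free_mul K I).
Proof. by rewrite free_mul.unlock free_one.unlock; apply: (@mul1r M). Qed.
Fact free_mulr1 : right_id (@free_one K I) (@free_mul K I).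
Proof. by rewrite free_mul.unlock free_one.unlock; apply: (@mulr1 M). Qed.
Fact free_mulDl : left_distributive (@free_mul K I) +%R.
Proof.
rewrite /(@GRing.add) /= free_mul.unlock free_add.unlock.
by apply: (@mulrDl M).
Qed.
Fact free_mulDr : right_distributive (@free_mul K I) +%R.
Proof.
rewrite /(@GRing.add) /= free_mul.unlock free_add.unlock.
by apply: (@mulrDr M).
Qed.
Fact free_one_neq0 : free_one K I != 0.
Proof.
have -> : (0 : T) = free_zero K I by [].
by rewrite free_one.unlock free_zero.unlock; apply: (@oner_neq0 M).
Qed.

HB.instance Definition _ := GRing.Zmodule_isNzRing.Build T
  free_mulA free_mul1 free_mulr1 free_mulDl free_mulDr free_one_neq0.

Fact free_scaleA a b (x : T) :
  free_scale a (free_scale b x) = free_scale (a * b) x.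
Proof. by rewrite free_scale.unlock; apply: (@scalerA K M). Qed.
Fact free_scale1 : left_id 1 (@free_scale K I).
Proof. by rewrite free_scale.unlock; apply: (@scale1r K M). Qed.
Fact free_scaleDr : right_distributive (@free_scale K I) +%R.
Proof.
rewrite /(@GRing.add) /= free_scale.unlock free_add.unlock.
by apply: (@scalerDr K M).
Qed.
Fact free_scaleDl (x : T) : {morph (@free_scale K I)^~ x : a b / a + b}.
Proof.
move=> a b; rewrite [RHS]/(@GRing.add) /= free_scale.unlock free_add.unlock.
by apply: (@scalerDl K M).
Qed.

HB.instance Definition _ := GRing.Zmodule_isLmodule.Build K T
  free_scaleA free_scale1 free_scaleDr free_scaleDl.

Lemma free_zeroE : (0 : T) = (0 : M).
Proof. by rewrite -[LHS]/(free_zero K I) free_zero.unlock. Qed.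
Lemma free_oneE : (1 : T) = (1 : M).
Proof. by rewrite -[LHS]/(free_one K I) free_one.unlock. Qed.
Lemma free_oppE (x : T) : - x = - (x : M).
Proof. by rewrite -[LHS]/(free_opp x) free_opp.unlock. Qed.
Lemma free_addE (x y : T) : x + y = (x : M) + y.
Proof. by rewrite -[LHS]/(free_add x y) free_add.unlock. Qed.
Lemma free_mulE (x y : T) : x * y = (x : M) * y.
Proof. by rewrite -[LHS]/(free_mul x y) free_mul.unlock. Qed.
Lemma free_scaleE a (x : T) : a *: x = a *: (x : M).
Proof. by rewrite -[LHS]/(free_scale a x) free_scale.unlock. Qed.

Fact free_scaleAl a (x y : T) : a *: (x * y) = a *: x * y.
Proof. by rewrite !free_mulE !free_scaleE; apply: (@scalerAl K M). Qed.

HB.instance Definition _ := GRing.Lmodule_isLalgebra.Build K T free_scaleAl.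

Fact free_scaleAr a (x y : T) : a *: (x * y) = x * (a *: y).
Proof.
have cent (z : M) : a%:MP * z = z * a%:MP.
  rewrite mul_malgC malgZ_def malgM_def fgmulgU.
  by apply: eq_bigr => k _; rewrite mulm1 mulrC.
rewrite !free_mulE !free_scaleE; transitivity (a%:MP * ((x : M) * y)).
  by rewrite mul_malgC.
by rewrite mulrA cent -mulrA mul_malgC.
Qed.

HB.instance Definition _ := GRing.Lalgebra_isAlgebra.Build K T free_scaleAr.

End FreeAlgebra.

HB.lock Definition free_gen (K : fieldType) (I : choiceType) (i : I)
  : free_alg K I := << fmu i >>.

Section AlgQuotient.
Variables (K : fieldType) (T : algType K) (R : T -> Prop).

Inductive ideal_span : T -> Prop :=
| ideal_span_incl x r y : R r -> ideal_span (x * r * y).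

(* T modulo the two-sided ideal generated by R, spanned by the x * r * y.
   It carries a pzRingType and an lmodType structure rather than an algType one,
   as the latter would require a proof that the quotient is nonzero. *)
Definition alg_quot : Type := lmod_quot ideal_span.

HB.instance Definition _ := GRing.Lmodule.on alg_quot.

Definition alg_pi (x : T) : alg_quot := lmod_pi ideal_span x.
Definition alg_repr (a : alg_quot) : T := lmod_repr a.

HB.instance Definition _ := GRing.Linear.copy alg_pi (lmod_pi ideal_span).

Lemma alg_reprK : cancel alg_repr alg_pi.
Proof. exact: lmod_reprK. Qed.

Definition alg_quot_one : alg_quot := alg_pi 1.
Definition alg_quot_mul (a b : alg_quot) : alg_quot :=
  alg_pi (alg_repr a * alg_repr b).

Lemma alg_piM : {morph alg_pi : x y / x * y >-> alg_quot_mul x y}.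
Proof.
move=> x y; apply/esym/lmod_piP.
set x' := alg_repr _; set y' := alg_repr _.
have -> : x' * y' - x * y = x' * (y' - y) + (x' - x) * y.
  by rewrite mulrBr mulrBl addrA subrK.
rewrite -[_ * (y' - y)]scale1r; apply: span_lin.
  have := lmod_repr_pi ideal_span y.
  apply: (@span_linear _ _ _ (x' \*o idfun)).
  move=> _ [z r w Rr] /=; rewrite !mulrA; apply: span_incl.
  exact: ideal_span_incl.
have := lmod_repr_pi ideal_span x.
apply: (@span_linear _ _ _ (y \o* idfun)).
move=> _ [z r w Rr] /=; rewrite -!mulrA mulrA; apply: span_incl.
exact: ideal_span_incl.
Qed.

Lemma alg_quot_mulA : associative alg_quot_mul.
Proof.
move=> a b c; rewrite -[a]alg_reprK -[b]alg_reprK -[c]alg_reprK.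
by rewrite -!alg_piM mulrA.
Qed.

Lemma alg_quot_mul1 : left_id alg_quot_one alg_quot_mul.
Proof. by move=> a; rewrite -[a]alg_reprK -alg_piM mul1r. Qed.

Lemma alg_quot_mulr1 : right_id alg_quot_one alg_quot_mul.
Proof. by move=> a; rewrite -[a]alg_reprK -alg_piM mulr1. Qed.

Lemma alg_quot_mulDl : left_distributive alg_quot_mul +%R.
Proof.
move=> a b c; rewrite -[a]alg_reprK -[b]alg_reprK -[c]alg_reprK.
by rewrite -raddfD -!alg_piM mulrDl raddfD.
Qed.

Lemma alg_quot_mulDr : right_distributive alg_quot_mul +%R.
Proof.
move=> a b c; rewrite -[a]alg_reprK -[b]alg_reprK -[c]alg_reprK.
by rewrite -raddfD -!alg_piM mulrDr raddfD.
Qed.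

HB.instance Definition _ := GRing.Zmodule_isPzRing.Build alg_quot
  alg_quot_mulA alg_quot_mul1 alg_quot_mulr1 alg_quot_mulDl alg_quot_mulDr.

Lemma alg_pi_is_monoid_morphism : monoid_morphism alg_pi.
Proof. by split=> // x y; rewrite alg_piM. Qed.

HB.instance Definition _ :=
  GRing.isMonoidMorphism.Build T alg_quot alg_pi alg_pi_is_monoid_morphism.

Lemma alg_piD x y : alg_pi (x + y) = alg_pi x + alg_pi y.
Proof. exact: raddfD. Qed.

Lemma alg_pi_mul x y : alg_pi (x * y) = alg_pi x * alg_pi y.
Proof. exact: alg_piM. Qed.

Lemma alg_piZ k x : alg_pi (k *: x) = k *: alg_pi x.
Proof. exact: linearZ. Qed.

Lemma alg_quot_scaleAl (k : K) (a b : alg_quot) : k *: (a * b) = k *: a * b.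
Proof.
rewrite -[a]alg_reprK -[b]alg_reprK -rmorphM -!linearZ -rmorphM /=.
by rewrite scalerAl.
Qed.

Lemma alg_quot_scaleAr (k : K) (a b : alg_quot) : k *: (a * b) = a * (k *: b).
Proof.
rewrite -[a]alg_reprK -[b]alg_reprK -rmorphM -!linearZ -rmorphM /=.
by rewrite scalerAr.
Qed.

End AlgQuotient.

Section LeftQuotient.
Variables (K : fieldType) (T : algType K) (R : T -> Prop).
Local Notation A := (alg_quot R).
Variable S : A -> Prop.

Inductive left_ideal_span : A -> Prop :=
| left_ideal_span_incl a s : S s -> left_ideal_span (a * s).

(* A modulo the left ideal generated by S, which is spanned by the a * s *)
Definition left_quot : Type := lmod_quot left_ideal_span.

HB.instance Definition _ := GRing.Lmodule.on left_quot.

Definition left_pi (a : A) : left_quot := lmod_pi left_ideal_span a.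

HB.instance Definition _ := GRing.Linear.copy left_pi (lmod_pi left_ideal_span).

Definition left_act (a : A) (v : left_quot) : left_quot :=
  left_pi (a * lmod_repr v).

Lemma left_act_pi (a b : A) : left_act a (left_pi b) = left_pi (a * b).
Proof.
apply/lmod_piP; rewrite -mulrBr.
elim: (lmod_repr_pi left_ideal_span b) => [_ [c s Ss]||k u v _ au _ av].
- by rewrite mulrA; apply: span_incl; apply: left_ideal_span_incl.
- by rewrite mulr0; apply: span0.
- by rewrite mulrDr -alg_quot_scaleAr; apply: span_lin.
Qed.

Lemma left_act_is_linear a : linear (left_act a).
Proof.
move=> k u v; rewrite -[u]lmod_reprK -[v]lmod_reprK -linearP !left_act_pi.
by rewrite mulrDr -alg_quot_scaleAr linearP.
Qed.

HB.instance Definition _ a := GRing.isLinear.Build K left_quot left_quot _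
  (left_act a) (left_act_is_linear a).

Lemma left_actM (a b : A) (v : left_quot) :
  left_act (a * b) v = left_act a (left_act b v).
Proof.
have -> : v = left_pi (lmod_repr v) by rewrite /left_pi lmod_reprK.
by rewrite !left_act_pi mulrA.
Qed.

Lemma left_actD (a b : A) v : left_act (a + b) v = left_act a v + left_act b v.
Proof. by rewrite /left_act mulrDl linearD. Qed.

Lemma left_actZ (k : K) (a : A) v : left_act (k *: a) v = k *: left_act a v.
Proof. by rewrite /left_act -alg_quot_scaleAl linearZ. Qed.

Lemma left_act1 v : left_act 1 v = v.
Proof. by rewrite /left_act mul1r /left_pi lmod_reprK. Qed.

End LeftQuotient.

Section Endomorphisms.
Variables (K : fieldType) (V : lmodType K).

Definition endo : Type := {linear V -> V}.

HB.instance Definition _ := gen_eqMixin endo.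
HB.instance Definition _ := gen_choiceMixin endo.

Implicit Types f g : endo.

Lemma endoP f g : (forall v, f v = g v) <-> f = g.
Proof.
split=> [|-> //]; case: f g => f [[f1] [f2]] [g [[g1] [g2]]] /= /funext e.
by subst g; rewrite (Prop_irrelevance g1 f1) (Prop_irrelevance g2 f2).
Qed.

Definition endo_zero : endo := \0.
Definition endo_opp f : endo := \- f.
Definition endo_add f g : endo := f \+ g.
Definition endo_scale (a : K) f : endo := a \*: f.
Definition endo_one : endo := idfun.
Definition endo_mul f g : endo := f \o g.

Fact endo_addA : associative endo_add.
Proof. by move=> f g k; apply/endoP => v /=; rewrite addrA. Qed.
Fact endo_addC : commutative endo_add.
Proof. by move=> f g; apply/endoP => v /=; rewrite addrC. Qed.
Fact endo_add0 : left_id endo_zero endo_add.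
Proof. by move=> f; apply/endoP => v /=; rewrite add0r. Qed.
Fact endo_addN : left_inverse endo_zero endo_opp endo_add.
Proof. by move=> f; apply/endoP => v /=; rewrite addNr. Qed.

HB.instance Definition _ :=
  GRing.isZmodule.Build endo endo_addA endo_addC endo_add0 endo_addN.

Fact endo_mulA : associative endo_mul.
Proof. by move=> f g k; apply/endoP. Qed.
Fact endo_mul1 : left_id endo_one endo_mul.
Proof. by move=> f; apply/endoP. Qed.
Fact endo_mulr1 : right_id endo_one endo_mul.
Proof. by move=> f; apply/endoP. Qed.
Fact endo_mulDl : left_distributive endo_mul +%R.
Proof. by move=> f g k; apply/endoP. Qed.
Fact endo_mulDr : right_distributive endo_mul +%R.
Proof. by move=> f g k; apply/endoP => v /=; rewrite linearD. Qed.

HB.instance Definition _ := GRing.Zmodule_isPzRing.Build endo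
  endo_mulA endo_mul1 endo_mulr1 endo_mulDl endo_mulDr.

Fact endo_scaleA a b f : endo_scale a (endo_scale b f) = endo_scale (a * b) f.
Proof. by apply/endoP => v /=; rewrite scalerA. Qed.
Fact endo_scale1 : left_id 1 endo_scale.
Proof. by move=> f; apply/endoP => v /=; rewrite scale1r. Qed.
Fact endo_scaleDr : right_distributive endo_scale +%R.
Proof. by move=> a f g; apply/endoP => v /=; rewrite scalerDr. Qed.
Fact endo_scaleDl f : {morph endo_scale^~ f : a b / a + b}.
Proof. by move=> a b; apply/endoP => v /=; rewrite scalerDl. Qed.

HB.instance Definition _ := GRing.Zmodule_isLmodule.Build K endo
  endo_scaleA endo_scale1 endo_scaleDr endo_scaleDl.

Lemma endoDE f g v : (f + g) v = f v + g v. Proof. by []. Qed.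
Lemma endoNE f v : (- f) v = - f v. Proof. by []. Qed.
Lemma endo0E v : (0 : endo) v = 0. Proof. by []. Qed.
Lemma endoZE a f v : (a *: f) v = a *: f v. Proof. by []. Qed.
Lemma endo1E v : (1 : endo) v = v. Proof. by []. Qed.
Lemma endoME f g v : (f * g) v = f (g v). Proof. by []. Qed.

End Endomorphisms.

Section GeneratedSubalgebra.
Variables (K : fieldType) (V : lmodType K) (S : endo V -> Prop).

Inductive gen_subalg : endo V -> Prop :=
| gen_subalg_incl f : S f -> gen_subalg f
| gen_subalg1 : gen_subalg 1
| gen_subalg_lin a f g : gen_subalg f -> gen_subalg g -> gen_subalg (a *: f + g)
| gen_subalgM f g : gen_subalg f -> gen_subalg g -> gen_subalg (f * g).

Definition gen_subalg_pred : {pred endo V} := fun f => `[< gen_subalg f >].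

Lemma gen_subalg_predP f : reflect (gen_subalg f) (f \in gen_subalg_pred).
Proof. exact: asboolP. Qed.

Fact gen_subalg_subring : GRing.subring_closed gen_subalg_pred.
Proof.
split; first by apply/gen_subalg_predP; apply: gen_subalg1.
  move=> f g /gen_subalg_predP Sf /gen_subalg_predP Sg; apply/gen_subalg_predP.
  by rewrite -scaleN1r addrC; apply: gen_subalg_lin.
move=> f g /gen_subalg_predP Sf /gen_subalg_predP Sg; apply/gen_subalg_predP.
exact: gen_subalgM.
Qed.

HB.instance Definition _ :=
  GRing.isSubringClosed.Build (endo V) gen_subalg_pred gen_subalg_subring.

Fact gen_subalg_scaler : GRing.scaler_closed gen_subalg_pred.
Proof.
move=> a f /gen_subalg_predP Sf; apply/gen_subalg_predP.
rewrite -[a *: f]addr0 -[0](subrr 1) -scaleN1r [1 + _]addrC.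
by do !apply: gen_subalg_lin => //; apply: gen_subalg1.
Qed.

HB.instance Definition _ :=
  GRing.isScaleClosed.Build K (endo V) gen_subalg_pred gen_subalg_scaler.

Record gen_subalg_type :=
  GenSubalg { gen_subalg_val : endo V; _ : gen_subalg_val \in gen_subalg_pred }.

HB.instance Definition _ := [isSub for gen_subalg_val].
HB.instance Definition _ := [Choice of gen_subalg_type by <:].
HB.instance Definition _ := GRing.SubChoice_isSubPzRing.Build _ _
  gen_subalg_type gen_subalg_subring.
HB.instance Definition _ := [SubZmodule_isSubLmodule of gen_subalg_type by <:].

Definition gen_subalg_gen f (Sf : S f) : gen_subalg_type :=
  GenSubalg (introT (gen_subalg_predP f) (gen_subalg_incl Sf)).

End GeneratedSubalgebra.

Lemma lmod_quot_map_ex (K : fieldType) (V W : lmodType K)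
    (S : V -> Prop) (S' : W -> Prop) (f : {linear V -> W}) :
  (forall v, S v -> span S' (f v)) ->
  exists g : {linear lmod_quot S -> lmod_quot S'},
    forall v, g (lmod_pi S v) = lmod_pi S' (f v).
Proof.
move=> fS; pose g (x : lmod_quot S) := lmod_pi S' (f (lmod_repr x)).
have gE v : g (lmod_pi S v) = lmod_pi S' (f v).
  apply/lmod_piP; rewrite -linearB.
  by apply: (span_linear fS); apply: lmod_repr_pi.
have g_lin : linear g.
  move=> a x y; rewrite -[x]lmod_reprK -[y]lmod_reprK -linearP !gE.
  by rewrite !linearP.
pose gL := GRing.isLinear.Build K _ _ _ g g_lin.
by exists (HB.pack_for {linear lmod_quot S -> lmod_quot S'} g gL).
Qed.

Lemma free_alg_ind (K : fieldType) (I : choiceType) (Q : free_alg K I -> Prop) :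
    Q 1 -> (forall i x, Q x -> Q (free_gen K i * x)) ->
    (forall a x y, Q x -> Q y -> Q (a *: x + y)) ->
  forall x, Q x.
Proof.
move=> Q1 Qgen Qlin x.
have Q0 : Q 0 by rewrite -(addNr 1) -scaleN1r; apply: Qlin.
have Qmon (s : seq I) : Q (<< FMonom s >> : {malg K[{fmonom I}]}).
  elim: s => [|i s IH].
    have -> // : << FMonom [::] >> = (1 : free_alg K I).
    by rewrite free_oneE; congr << _ >>; rewrite /mone /= /fmone fmE.
  have -> : << FMonom (i :: s) >> =
      free_gen K i * (<< FMonom s >> : {malg K[{fmonom I}]}) :> free_alg K I.
    rewrite free_mulE free_gen.unlock malgM_def fgmulUU mulr1; congr << _ >>.
    by rewrite /mmul /= /fmmul /fmu !fmE.
  exact: Qgen.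
have Qsum (c : {fmonom I} -> K) (s : seq {fmonom I}) :
    Q (\sum_(k <- s) c k *: (<< k >> : {malg K[{fmonom I}]})).
  elim: s => [|[k] s IH]; first by rewrite big_nil -free_zeroE.
  by rewrite big_cons -free_scaleE -free_addE; apply: Qlin.
suff -> : x = \sum_(k <- msupp (x : {malg K[{fmonom I}]}))
    x@_k *: (<< k >> : {malg K[{fmonom I}]}) by apply: Qsum.
rewrite [LHS](monalgE x); apply: eq_bigr => k _.
by apply/malgP => l; rewrite mcoeffZ !mcoeffU mulr_natr.
Qed.

Section MalgParity.
Variables (K : comNzRingType) (X : monomType) (deg : X -> nat).
Hypothesis deg1 : deg mone = 0%N.
Hypothesis degM : forall k l, deg (mmul k l) = (deg k + deg l)%N.
Local Notation M := {malg K[X]}.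

Definition malg_parity (x : M) : M :=
  \sum_(k <- msupp x) << (-1) ^+ deg k * x@_k *g k >>.

Lemma malg_parityE x k : (malg_parity x)@_k = (-1) ^+ deg k * x@_k.
Proof.
rewrite {2}[x]monalgE /malg_parity !raddf_sum mulr_sumr /=.
apply: eq_bigr => i _; rewrite !mcoeffU.
by have [->|] := eqVneq; rewrite ?mulr1n // mulr0n mulr0.
Qed.

Lemma malg_parityP a x y :
  malg_parity (a *: x + y) = a *: malg_parity x + malg_parity y.
Proof.
apply/malgP => k.
by rewrite malg_parityE !(mcoeffD, mcoeffZ) !malg_parityE mulrDr mulrCA.
Qed.

Lemma malg_parityM x y : malg_parity (x * y) = malg_parity x * malg_parity y.
Proof.
have supp (z : M) : (msupp (malg_parity z) `<=` msupp z)%fset.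
  apply/fsubsetP => k; rewrite -!mcoeff_neq0 malg_parityE.
  by apply: contraNneq => ->; rewrite mulr0.
apply/malgP => k; rewrite malg_parityE.
rewrite mcoeffMl (mcoeffMlw _ (supp x) (supp y)) mulr_sumr.
apply: eq_bigr => k1 _; rewrite mulr_sumr; apply: eq_bigr => k2 _.
rewrite !malg_parityE; have [<-|] := eqVneq; last by rewrite !mulr0n mulr0.
by rewrite !mulr1n degM exprD mulrACA.
Qed.

Lemma malg_parity1 : malg_parity 1 = 1.
Proof.
apply/malgP => k; rewrite malg_parityE mcoeff1.
by have [->|] := eqVneq; rewrite ?mulr0 // deg1 mul1r.
Qed.

Lemma malg_parityU k : deg k = 1%N -> malg_parity << k >> = - << k >>.
Proof.
move=> k1; apply/malgP => l; rewrite malg_parityE mcoeffN mcoeffU1.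
by have [<-|] := eqVneq; rewrite ?mulr0 ?oppr0 // k1 expr1 mulr1.
Qed.

End MalgParity.

Section FreeParity.
Variables (K : fieldType) (I : choiceType).
Local Notation T := (free_alg K I).

Definition free_parity : T -> T := @malg_parity K {fmonom I} (@fdeg I).

Lemma free_parity_is_linear : linear free_parity.
Proof.
move=> a x y; rewrite !(free_addE, free_scaleE).
exact: (@malg_parityP K {fmonom I} (@fdeg I)).
Qed.

HB.instance Definition _ :=
  GRing.isLinear.Build K T T _ free_parity free_parity_is_linear.

Lemma free_parityM : {morph free_parity : x y / x * y}.
Proof. by move=> x y; rewrite !free_mulE; apply: (malg_parityM (@fdegM I)). Qed.

Lemma free_parity1 : free_parity 1 = 1.
Proof. by rewrite free_oneE; apply: (malg_parity1 _ (@fdeg1 I)). Qed.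

Lemma free_parity_gen i : free_parity (free_gen K i) = - free_gen K i.
Proof.
rewrite free_oppE free_gen.unlock.
by apply: malg_parityU; apply: fdegU.
Qed.

End FreeParity.

Section SymplecticFermions.
Variables (K : fieldType) (h : vectType K) (form : {skew_symmetric h}).

Local Notation gen x n := (free_gen K (x, n)).

(* The h_n are odd, so that their supercommutator is the anticommutator; all the
   relations are homogeneous, hence respect parity. *)
Inductive sf_relation : free_alg K (h * int)%type -> Prop :=
| sf_linear a x y n :
    sf_relation (gen (a *: x + y) n - (a *: gen x n + gen y n))
| sf_anticommutator x y m n :
    sf_relation (gen x m * gen y n + gen y n * gen x m
                 - (m%:~R * form x y * (m + n == 0)%:R)%:A).

Definition sf_algebra : Type := alg_quot sf_relation.

HB.instance Definition _ := GRing.PzRing.on sf_algebra.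
HB.instance Definition _ := GRing.Lmodule.on sf_algebra.

Definition sf_mode (x : h) (n : int) : sf_algebra :=
  alg_pi sf_relation (gen x n).

Inductive sf_positive_mode : sf_algebra -> Prop :=
| sf_positive_mode_intro x n : 0 < n -> sf_positive_mode (sf_mode x n).

Definition fock : Type := left_quot sf_positive_mode.

HB.instance Definition _ := GRing.Lmodule.on fock.

Definition vacuum : fock := left_pi sf_positive_mode 1.

Definition fock_act (a : sf_algebra) : endo fock := left_act a.

(* The vector h^1_(-n_1) ... h^r_(-n_r) |0>, for s = [:: (h^1, n_1); ...] *)
Definition fock_word (s : seq (h * nat)) : fock :=
  fock_act (\prod_(p <- s) sf_mode p.1 (- p.2%:Z)) vacuum.

(* The even (b = false) and odd (b = true) parts *)
Definition fock_part (b : bool) : fock -> Prop :=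
  span (fun v => exists2 s, odd (size s) = b & v = fock_word s).

Definition is_parity_operator (k : endo fock) : Prop :=
  (forall v, fock_part false v -> k v = v) /\
  (forall v, fock_part true v -> k v = - v).

End SymplecticFermions.

Section Parity.
Variables (K : fieldType) (h : vectType K) (form : {skew_symmetric h}).

Lemma fock_actM (a b : sf_algebra form) :
  fock_act (a * b) = fock_act a * fock_act b.
Proof. by apply/endoP => v; apply: left_actM. Qed.

Lemma sf_parity_ex : exists s : {linear sf_algebra form -> sf_algebra form},
  [/\ s 1 = 1, {morph s : a b / a * b} &
      forall x n, s (sf_mode form x n) = - sf_mode form x n].
Proof.
pose sigma : {linear _ -> _} := @free_parity K (h * int)%type.
have sR : forall v, ideal_span (sf_relation form) v ->
    span (ideal_span (sf_relation form)) (sigma v).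
  move=> _ [x r y Rr] /=; rewrite !free_parityM.
  have [->|->] : free_parity r = r \/ free_parity r = - r.
  - case: Rr => [a u v n|u v m n]; [right|left].
      rewrite linearB linearP /= !free_parity_gen.
      by rewrite scalerN -opprD -opprD.
    rewrite linearB linearD linearZ /= !free_parityM !free_parity_gen.
    by rewrite !mulrNN free_parity1.
  - by apply: span_incl; apply: ideal_span_incl.
  - rewrite mulrN mulNr -scaleN1r; apply: span_scale.
    by apply: span_incl; apply: ideal_span_incl.
have [s sE] := lmod_quot_map_ex sR; exists s; split.
- by rewrite [LHS]sE /= free_parity1.
- move=> a b; rewrite -[a]alg_reprK -[b]alg_reprK -rmorphM.
  by rewrite ![s _]sE /= free_parityM; apply: alg_piM.
- by move=> x n; rewrite [LHS]sE /= free_parity_gen linearN.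
Qed.

Lemma parity_operator_ex : exists k : endo (fock form), is_parity_operator k.
Proof.
have [s [s1 sM sg]] := sf_parity_ex.
have sS : forall v, left_ideal_span (sf_positive_mode (form := form)) v ->
    span (left_ideal_span (sf_positive_mode (form := form))) (s v).
  move=> _ [a _ [x n n_gt0]]; rewrite sM sg mulrN -scaleN1r.
  by apply/span_scale/span_incl; apply: left_ideal_span_incl.
have [k kE] := lmod_quot_map_ex sS; exists k.
have kw w : k (fock_word form w) = (-1) ^+ odd (size w) *: fock_word form w.
  rewrite signr_odd /fock_word /= left_act_pi mulr1 [LHS]kE -[RHS]linearZ.
  congr (lmod_pi _ _); elim: w => [|p w IH].
    by rewrite big_nil s1 scale1r.
  rewrite big_cons sM sg IH -alg_quot_scaleAr mulNr scalerN exprS mulN1r.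
  by rewrite scaleNr.
split=> v.
- elim=> [{}v [w w_even ->]||a x y _ IHx _ IHy]; rewrite ?linear0 //.
    by rewrite kw w_even scale1r.
  by rewrite linearP IHx IHy.
- elim=> [{}v [w w_odd ->]||a x y _ IHx _ IHy]; rewrite ?linear0 ?oppr0 //.
    by rewrite kw w_odd scaleN1r.
  by rewrite linearP IHx IHy scalerN opprD.
Qed.


Lemma sf_mode_is_linear n : linear (fun x => sf_mode form x n).
Proof.
move=> a x y; rewrite /sf_mode -linearP; apply/lmod_piP/span_incl.
rewrite -[X in ideal_span _ X]mulr1 -[X in ideal_span _ (X * _)]mul1r.
by apply: ideal_span_incl; apply: sf_linear.
Qed.

Lemma sf_mode_anticommutator x y m n :
  sf_mode form x m * sf_mode form y n + sf_mode form y n * sf_mode form x m =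
  (m%:~R * form x y * (m + n == 0)%:R) *: (1 : sf_algebra form).
Proof.
pose p := alg_pi (sf_relation form).
pose g z k : free_alg K (h * int)%type := free_gen K (z, k).
set c := _ * _ * _.
have -> : c *: (1 : sf_algebra form) = p (c *: 1) by rewrite /p alg_piZ.
transitivity (p (g x m * g y n + g y n * g x m)).
  by rewrite /p alg_piD !alg_pi_mul.
apply/lmod_piP/span_incl.
rewrite -[X in ideal_span _ X]mulr1 -[X in ideal_span _ (X * _)]mul1r.
by apply: ideal_span_incl; apply: sf_anticommutator.
Qed.

Lemma fock_actD (a b : sf_algebra form) v :
  fock_act (a + b) v = fock_act a v + fock_act b v.
Proof. exact: left_actD. Qed.

Lemma fock_actZ c (a : sf_algebra form) v :
  fock_act (c *: a) v = c *: fock_act a v.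
Proof. exact: left_actZ. Qed.

Lemma fock_act1 v : fock_act (1 : sf_algebra form) v = v.
Proof. exact: left_act1. Qed.

Lemma fock_act_vacuum x n : 0 < n ->
  fock_act (sf_mode form x n) (vacuum form) = 0.
Proof.
move=> n_gt0; rewrite /fock_act /= left_act_pi mulr1.
rewrite -[RHS](linear0 (left_pi (sf_positive_mode (form := form)))).
apply/lmod_piP; rewrite subr0 -[X in span _ X]mul1r.
by apply: span_incl; apply: left_ideal_span_incl.
Qed.

Lemma fock_word_cons x n s : fock_word form ((x, n) :: s) =
  fock_act (sf_mode form x (- n%:Z)) (fock_word form s).
Proof. by rewrite /fock_word big_cons fock_actM. Qed.

Lemma fock_word_nil : fock_word form [::] = vacuum form.
Proof. by rewrite /fock_word big_nil fock_act1. Qed.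

Lemma fock_spanned v : span (fun u => exists s, u = fock_word form s) v.
Proof.
set G := fun u => _; set W := span G.
have WN u : W u -> W (- u) by move=> Wu; rewrite -scaleN1r; apply: span_scale.
have WD u1 u2 : W u1 -> W u2 -> W (u1 + u2).
  by move=> W1 W2; rewrite -[u1]scale1r; apply: span_lin.
have Wneg x (n : nat) u : W u -> W (fock_act (sf_mode form x (- n%:Z)) u).
  apply: span_linear u => _ [s ->]; rewrite -fock_word_cons.
  by apply: span_incl; eexists.
have Wpos x n u : 0 < n -> W u -> W (fock_act (sf_mode form x n) u).
  move=> n_gt0; apply: span_linear u => _ [s ->].
  elim: s => [|[y k] s IH].
    by rewrite fock_word_nil fock_act_vacuum //; apply: span0.
  rewrite fock_word_cons -endoME -fock_actM.
  have -> := canRL (addrK _) (sf_mode_anticommutator x y n (- k%:Z)).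
  rewrite fock_actD fock_actZ fock_act1 -scaleN1r fock_actZ scaleN1r.
  apply: WD; first by apply: span_scale; apply: span_incl; eexists.
  by apply: WN; rewrite fock_actM endoME; apply: Wneg.
have Wmode x n u : W u -> W (fock_act (sf_mode form x n) u).
  case: (ltrP 0 n) => [|n_le0]; first exact: Wpos.
  by rewrite -[n]opprK -[- n]gez0_abs ?oppr_ge0 //; apply: Wneg.
have -> : v = fock_act (lmod_repr v) (vacuum form).
  by rewrite /fock_act /= left_act_pi mulr1 /left_pi lmod_reprK.
have -> : lmod_repr v = alg_pi (sf_relation form) (alg_repr (lmod_repr v)).
  by rewrite alg_reprK.
move: (alg_repr _); apply: free_alg_ind => [|[x n] a Wa|c a b Wa Wb].
- rewrite fock_act1 -fock_word_nil.
  by apply: span_incl; eexists.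
- by rewrite rmorphM fock_actM endoME; apply: Wmode.
- by rewrite linearP fock_actD fock_actZ; apply: span_lin.
Qed.

Lemma parity_operator_uniq (k1 k2 : endo (fock form)) :
  is_parity_operator k1 -> is_parity_operator k2 -> k1 = k2.
Proof.
move=> [k1e k1o] [k2e k2o]; apply/endoP => v.
elim: (fock_spanned v) => [_ [s ->]||a u w _ IHu _ IHw].
- case s_odd : (odd (size s)).
    by rewrite k1o ?k2o //; apply: span_incl; exists s.
  by rewrite k1e ?k2e //; apply: span_incl; exists s.
- by rewrite !linear0.
- by rewrite !linearP IHu IHw.
Qed.

(* Uniquely determined, by parity_operator_uniq *)
Definition parity_operator : endo (fock form) := sval (cid parity_operator_ex).

Lemma parity_operatorP : is_parity_operator parity_operator.
Proof. exact: svalP (cid parity_operator_ex). Qed.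

End Parity.

Section OperatorAlgebra.
Variables (K : fieldType) (h : vectType K) (form : {skew_symmetric h}).
Variables (d : nat) (phi psi : 'I_d -> h).

Inductive op_generator : endo (fock form) -> Prop :=
| op_generator_e i : op_generator (fock_act (sf_mode form (phi i) 0))
| op_generator_f i : op_generator (fock_act (sf_mode form (psi i) 0))
| op_generator_K : op_generator (parity_operator form).

Definition op_algebra : Type := gen_subalg_type op_generator.

HB.instance Definition _ := GRing.PzRing.on op_algebra.
HB.instance Definition _ := GRing.Lmodule.on op_algebra.

Definition op_e i : op_algebra := gen_subalg_gen (op_generator_e i).
Definition op_f i : op_algebra := gen_subalg_gen (op_generator_f i).
Definition op_K : op_algebra := gen_subalg_gen op_generator_K.

(* \prod is taken in increasing order of i, which matters as op_algebra is not
   commutative. *)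
Definition Omega (m n : 'I_d -> bool) (l : bool) : op_algebra :=
  (\prod_(i < d) (op_e i ^+ m i * op_f i ^+ n i)) * op_K ^+ l.

End OperatorAlgebra.

(* Main.v *)
From HB Require Import structures.
Require Import Defs.
From mathcomp Require Import all_boot all_order all_algebra.
From mathcomp Require Import sesquilinear finmap boolp functions monalg.
From mathcomp Require Import reals complex.
From mathcomp Require Import ring zify.

(** The relation for zero modes has right-hand side 0, so the $e_i$ and $f_i$
    anticommute and square to 0, while $K$ anticommutes with each of them and
    squares to 1 (the operator $K$ is called [kappa] below).  Hence $P$ is
    spanned by the monomials $w_A K^\ell$, where $w_A$ is the product, in the
    order $e_1, f_1, e_2, f_2, \dots$, of the generators in a subset $A$ of
    $\{e_1, f_1, \dots, e_d, f_d\}$ ([gen_subalg_comb]).  Everything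
    then rests on one linear form on $P$ that vanishes on words in the
    $e_i, f_i$, and that is nonzero on such a word times $K$ exactly when the
    word contains each generator once.

    Such a form gives the theorem.  Non-degeneracy: the monomial with the
    complementary set and the opposite power of $K$ pairs nontrivially with
    $w_A K^\ell$ and with no other monomial ([Psi_gram]).  Symmetry: moving $K$
    across the words and exchanging them produces signs that cancel, because
    two words that pair nontrivially have lengths of the same parity, the
    total length being $2d$ ([Psi_words_sym]).

    The existence of the form ([trace_form_ex]) amounts to the linear
    independence of the monomials, and this is where the Fock space itself
    enters.  On the space that the zero modes generate from $|0\rangle$,
    $e_1 f_1 \cdots e_d f_d K$ and $e_1 f_1 \cdots e_d f_d$ coincide as
    operators; to tell them apart one compares the action on the even
    vector $|0\rangle$ with that on the odd vector
    $\phi^1_{-1}|0\rangle$.  With $\lambda(v)$ the coefficient of the top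
    zero-mode vector in $v$, the form is, up to a scalar,
    $$x \mapsto \lambda(x|0\rangle)
       - \lambda(\psi^1_1\, x\, \phi^1_{-1}|0\rangle).$$
    For a word $x$ the two terms are equal and cancel; when $x$ is a word times
    $K$, the extra sign of $K$ on the odd vector makes them add up.

    The functional $\lambda$ must be defined on a space given by generators
    and relations.  The Fock space has a universal property
    ([fock_map_ex]): a realization of the modes on any space, with a
    vector killed by the positive modes, receives a map from it.  The
    realization used here is the Jordan-Wigner one, on functions of infinite
    bit strings, where $\lambda$ is evaluation at one string
    ([jw_top_coefficient]). *)

Set Implicit Arguments.
Unset Strict Implicit.
Unset Printing Implicit Defensive.

Import Order.TTheory GRing.Theory Num.Theory.
Local Open Scope ring_scope.

(** * Fermionic operators on functions of infinite bit strings *)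

Section JordanWigner.
Variable K : fieldType.

Definition bits := nat -> bool.

(** Arbitrary functions, rather than finitely supported ones, are allowed:
    only the existence of a module is at stake, and sums over states never
    occur. *)
Definition bit_space : Type := bits -> K^o.
HB.instance Definition _ := GRing.Lmodule.on bit_space.

Definition flip (j : nat) (S : bits) : bits := fun k => S k (+) (k == j).

Lemma flipK j S : flip j (flip j S) = S.
Proof. by apply/funext => k; rewrite /flip -addbA addbb addbF. Qed.

Lemma flipC j k S : flip j (flip k S) = flip k (flip j S).
Proof. by apply/funext => l; rewrite /flip addbAC. Qed.

(** The sign attached to position [j] counts the occupied positions below it;
    this is what makes operators at different positions anticommute instead
    of commuting. *)
Definition jw_sign (j : nat) (S : bits) : K := \prod_(i < j) (-1) ^+ S i.

Lemma jw_sign_flip j k S : jw_sign j (flip k S) = (-1) ^+ (k < j)%N * jw_sign j S.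
Proof.
elim: j => [|j IH]; first by rewrite /jw_sign !big_ord0 mulr1.
rewrite /jw_sign !big_ord_recr /= -!/(jw_sign _ _) IH /flip signr_addb.
rewrite [in RHS]ltnS [in RHS]leq_eqVlt.
by case: (ltngtP k j) => _ /=; rewrite ?expr0 ?expr1; ring.
Qed.

Lemma jw_sign_sqr j S : jw_sign j S * jw_sign j S = 1.
Proof.
rewrite /jw_sign -big_split big1 // => i _ /=.
by rewrite -expr2 sqrr_sign.
Qed.

(** Functions are pulled back along bit flips, so [b] is the value of bit [j]
    after the operator has acted: [b = true] is creation at [j], and
    [b = false] annihilation. *)
Definition jw_fun (b : bool) (j : nat) (f : bit_space) : bit_space :=
  fun S => (S j == b)%:R * jw_sign j S * f (flip j S).

Fact jw_fun_is_linear b j : linear (jw_fun b j).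
Proof.
move=> a f g; apply/funext => S.
rewrite [RHS]/(a *: (_ * f _ : K^o) + _ * g _ : K^o).
rewrite /jw_fun [X in _ * X]/(a *: f (flip j S) + g (flip j S)).
by rewrite mulrDr /GRing.scale /= mulrCA.
Qed.
HB.instance Definition _ b j :=
  GRing.isLinear.Build K bit_space bit_space _ (jw_fun b j) (jw_fun_is_linear b j).

Definition jw (b : bool) (j : nat) : endo bit_space := jw_fun b j.

Lemma jwE b j f S : jw b j f S = (S j == b)%:R * jw_sign j S * f (flip j S).
Proof. by []. Qed.

(** The canonical anticommutation relations.  At different positions one of
    the two flips changes the sign of the other operator, the one at the
    larger position; at the same position the two squares vanish and the two
    mixed products are complementary projections. *)
Lemma jw_anticommutator b c j k :
  jw b j * jw c k + jw c k * jw b j =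
  ((j == k) && (b != c))%:R *: (1 : endo bit_space).
Proof.
apply/endoP => f; apply/funext => S.
transitivity (jw b j (jw c k f) S + jw c k (jw b j f) S : K); first by [].
transitivity (((j == k) && (b != c))%:R * f S : K); last by [].
rewrite !jwE !jw_sign_flip.
have [->|jk] := eqVneq j k.
  have flip_kk : flip k S k = ~~ S k by rewrite /flip eqxx addbT.
  rewrite flipK ltnn expr0 mul1r flip_kk andTb.
  transitivity (((S k == b)%:R * (~~ S k == c)%:R
      + (S k == c)%:R * (~~ S k == b)%:R) * (jw_sign k S * jw_sign k S) * f S : K).
    by ring.
  rewrite jw_sign_sqr mulr1; congr (_ * _).
  by case: (S k) b c => [] [] []; rewrite !(mul1r, mul0r, mulr0, addr0, add0r).
have flip_jk : flip j S k = S k by rewrite /flip eq_sym (negPf jk) addbF.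
have flip_kj : flip k S j = S j by rewrite /flip (negPf jk) addbF.
rewrite flip_jk flip_kj andFb mul0r flipC.
by case: ltngtP jk => // _ _; rewrite expr0 expr1; ring.
Qed.

Definition jw_vacuum : bit_space := fun S => `[< forall j, S j = false >]%:R.

Lemma jw_annihilates_vacuum j : jw false j jw_vacuum = 0.
Proof.
apply/funext => S; rewrite jwE /jw_vacuum; case Sj: (S j).
  by rewrite !mul0r.
case: asboolP => [/(_ j)|_]; last by rewrite mulr0.
by rewrite /flip Sj eqxx.
Qed.

(** Each creator fills one empty position, so a product of creators takes the
    vacuum to the state, up to sign, whose occupied positions are the indices
    of the product, and a repeated index gives 0. *)
Lemma jw_creators_neq0 (s : seq nat) S :
  (\prod_(j <- s) jw true j) jw_vacuum S != 0
    <-> forall k, S k = count_mem k s :> nat.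
Proof.
elim: s S => [|j s IH] S.
  rewrite big_nil endo1E /jw_vacuum.
  case: asboolP => [S0|nS0]; rewrite ?oner_eq0 ?eqxx.
    by split=> // _ k; rewrite S0.
  by split=> // S0; case: nS0 => k; move: (S0 k); case: (S k).
rewrite big_cons endoME jwE !mulf_eq0 !negb_or.
have -> : jw_sign j S != 0.
  by apply/eqP => sg0; have := jw_sign_sqr j S; rewrite sg0 mul0r => /esym/eqP;
    rewrite oner_eq0.
rewrite andbT; split.
  case/andP; case Sj: (S j); rewrite ?eqxx //= => _ /IH cnt k.
  have := cnt k; rewrite /flip (eq_sym j k).
  have [->|_] := eqVneq k j; first by rewrite Sj /= => <-.
  by rewrite addbF.
move=> cnt; have := cnt j; rewrite /= eqxx; case Sj: (S j) => // /eqP.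
rewrite -[X in X == _]addn0 eqn_add2l eqxx oner_eq0 => /eqP cj.
apply/IH => k; have := cnt k; rewrite /flip /= (eq_sym j k).
have [->|_] := eqVneq k j; first by rewrite Sj -cj.
by rewrite addbF.
Qed.

Lemma jw_top_coefficient (L s : seq nat) : uniq L ->
  ((\prod_(j <- s) jw true j) jw_vacuum (fun k => k \in L) != 0) = perm_eq s L.
Proof.
move=> uL; apply/idP/idP => [/jw_creators_neq0 cnt|/permP sL].
  by apply/allP => k _ /=; rewrite -cnt count_uniq_mem.
by apply/jw_creators_neq0 => k; rewrite sL count_uniq_mem.
Qed.

End JordanWigner.

(** * The universal property of the Fock space *)

Section UniversalProperty.
Variable K : fieldType.

Lemma lmod_quot_lift_ex (V W : lmodType K) (S : V -> Prop)
    (f : {linear V -> W}) : (forall v, S v -> f v = 0) ->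
  exists g : {linear lmod_quot S -> W}, forall v, g (lmod_pi S v) = f v.
Proof.
move=> fS; pose g (x : lmod_quot S) := f (lmod_repr x).
have gE v : g (lmod_pi S v) = f v.
  by apply: (lmod_quot_lift fS); rewrite lmod_reprK.
have g_lin : linear g.
  move=> a x y; rewrite -[x]lmod_reprK -[y]lmod_reprK -linearP !gE.
  by rewrite linearP.
pose gL := GRing.isLinear.Build K _ _ _ g g_lin.
by exists (HB.pack_for {linear lmod_quot S -> W} g gL).
Qed.

Lemma endo_mulZ (W : lmodType K) a (f g : endo W) : f * (a *: g) = a *: (f * g).
Proof. by apply/endoP => v; rewrite endoME !endoZE linearZ. Qed.

Lemma endo_Zmul (W : lmodType K) a (f g : endo W) : (a *: f) * g = a *: (f * g).
Proof. by apply/endoP. Qed.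

(** The universal property of the free algebra: send a monomial to the product
    of the images of its letters.  Multiplicativity is first checked when the
    left factor is a generator, then extended by induction on that factor. *)
Lemma free_alg_rep_ex (I : choiceType) (W : lmodType K) (g : I -> endo W) :
  exists rho : {linear free_alg K I -> endo W},
    [/\ rho 1 = 1, {morph rho : x y / x * y} &
        forall i, rho (free_gen K i) = g i].
Proof.
pose word (k : {fmonom I}) : endo W := \prod_(i <- (k : seq I)) g i.
pose r (x : free_alg K I) : endo W :=
  \sum_(k <- msupp (x : {malg K[{fmonom I}]}))
    (x : {malg K[{fmonom I}]})@_k *: word k.
have rEw (E : {fset {fmonom I}}) (x : {malg K[{fmonom I}]}) :
    (msupp x `<=` E)%fset -> r x = \sum_(k <- E) x@_k *: word k.
  move=> xE; rewrite /r (big_fset_incl _ xE) //= => k _ /mcoeff_outdom ->.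
  by rewrite scale0r.
have r_lin : linear r.
  move=> a x y.
  pose E := (msupp (x : {malg K[{fmonom I}]}) `|`
    msupp (y : {malg K[{fmonom I}]}) `|`
    msupp ((a *: (x : {malg K[{fmonom I}]}) + y) : {malg K[{fmonom I}]}))%fset.
  rewrite free_addE free_scaleE !(rEw E); first last.
  - by rewrite /E fsubsetUr.
  - by rewrite /E -fsetUA fsubsetUl.
  - by rewrite /E fsetUAC fsubsetUr.
  rewrite scaler_sumr -big_split; apply: eq_bigr => k _ /=.
  by rewrite mcoeffD mcoeffZ scalerDl scalerA.
pose rL := GRing.isLinear.Build K _ _ _ r r_lin.
pose rho := HB.pack_for {linear free_alg K I -> endo W} r rL.
have rhoU k : rho (<< k >> : {malg K[{fmonom I}]}) = word k.
  rewrite [LHS](rEw [fset k]%fset) ?msuppU_le //.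
  by rewrite big_seq_fset1 mcoeffUU scale1r.
have rho1 : rho 1 = 1.
  by rewrite free_oneE rhoU /word fm1 big_nil.
have rho_gen_mul i x : rho (free_gen K i * x) = g i * rho x.
  have -> : x = \sum_(k <- msupp (x : {malg K[{fmonom I}]}))
      (x : {malg K[{fmonom I}]})@_k *: (<< k >> : {malg K[{fmonom I}]}).
    rewrite [LHS](monalgE x); apply: eq_bigr => k _.
    by apply/malgP => l; rewrite mcoeffZ !mcoeffU mulr_natr.
  elim: (X in \sum_(k <- X) _) => [|k s IH].
    by rewrite big_nil -free_zeroE mulr0 !linear0 mulr0.
  rewrite big_cons -free_scaleE -free_addE mulrDr !linearD IH mulrDr.
  congr (_ + _); rewrite -free_scaleAr !linearZ /= endo_mulZ; congr (_ *: _).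
  rewrite free_mulE free_gen.unlock malgM_def fgmulUU mulr1.
  transitivity (word (mmul (fmu i) k)); first exact: rhoU.
  transitivity (g i * word k); last by congr (_ * _); apply/esym/rhoU.
  have ik : (mmul (fmu i) k : {fmonom I}) = i :: k :> seq I.
    by rewrite /mmul /= /fmmul /fmu !fmE.
  by rewrite /word ik big_cons.
have rho_gen i : rho (free_gen K i) = g i.
  by rewrite -[free_gen K i]mulr1 rho_gen_mul rho1 mulr1.
exists rho; split=> // x y; move: x; apply: free_alg_ind.
- by rewrite rho1 !mul1r.
- by move=> i x IH; rewrite -mulrA !rho_gen_mul IH mulrA.
- move=> a x z IHx IHz.
  rewrite mulrDl -free_scaleAl (linearP rho a (x * y)) (linearP rho a x).
  by rewrite IHx IHz mulrDl endo_Zmul.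
Qed.

Section Fock.
Variables (h : vectType K) (form : {skew_symmetric h}).
Variables (W : lmodType K) (X : h -> int -> endo W) (w0 : W).
Hypothesis X_linear : forall a x y n, X (a *: x + y) n = a *: X x n + X y n.
Hypothesis X_anticommutator : forall x y m n,
  X x m * X y n + X y n * X x m =
  (m%:~R * form x y * (m + n == 0)%:R) *: (1 : endo W).
Hypothesis X_pos : forall x n, 0 < n -> X x n w0 = 0.

Lemma sf_rep_ex : exists rho : {linear sf_algebra form -> endo W},
  [/\ rho 1 = 1, {morph rho : a b / a * b} &
      forall x n, rho (sf_mode form x n) = X x n].
Proof.
have [r [r1 rM rg]] := free_alg_rep_ex (fun p : h * int => X p.1 p.2).
have r0 v : ideal_span (sf_relation form) v -> r v = 0.
  move=> [x _ y [a u w n|u w m n]]; rewrite !rM.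
    by rewrite linearB linearP /= !rg /= X_linear subrr mulr0 mul0r.
  rewrite linearB linearD linearZ /= !rM !rg r1 X_anticommutator.
  by rewrite subrr mulr0 mul0r.
have [rho rhoE] := lmod_quot_lift_ex r0; exists rho; split.
- by rewrite [LHS]rhoE.
- move=> a b; rewrite -[a]alg_reprK -[b]alg_reprK -rmorphM.
  by rewrite ![rho _]rhoE rM.
- by move=> x n; rewrite [LHS]rhoE rg.
Qed.

(** The Fock space is the universal module generated by a vector that the
    positive modes kill. *)
Lemma fock_map_ex : exists pi : {linear fock form -> W},
  pi (vacuum form) = w0 /\
  forall x n v, pi (fock_act (sf_mode form x n) v) = X x n (pi v).
Proof.
have [rho [rho1 rhoM rhoX]] := sf_rep_ex.
pose p (a : sf_algebra form) := rho a w0.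
have p_lin : linear p by move=> a x y; rewrite /p linearP.
pose pL := GRing.isLinear.Build K _ _ _ p p_lin.
pose pl := HB.pack_for {linear sf_algebra form -> W} p pL.
have p0 v : left_ideal_span (sf_positive_mode (form := form)) v -> pl v = 0.
  move=> [a _ [x n n_gt0]]; rewrite /= /p rhoM rhoX endoME X_pos //.
  exact: linear0.
have [pi piE] := lmod_quot_lift_ex p0; exists pi; split.
  by rewrite [LHS]piE /= /p rho1.
move=> x n v; rewrite -[v]lmod_reprK -!/(left_pi _ _).
rewrite /fock_act /= left_act_pi ![pi _]piE /= /p rhoM rhoX.
by [].
Qed.

End Fock.
End UniversalProperty.

(** * Grassmann algebras with a parity operator *)

Section GrassmannParity.
Variables (K : fieldType) (V : lmodType K) (T : finType).
Variables (g : T -> endo V) (kappa : endo V).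
Hypothesis g_sqr : forall t, g t * g t = 0.
Hypothesis g_anticomm : forall t u, g t * g u = - (g u * g t).
Hypothesis kappa_g : forall t, kappa * g t = - (g t * kappa).
Hypothesis kappa_sqr : kappa * kappa = 1.

Definition word (s : seq T) : endo V := \prod_(t <- s) g t.

Lemma word_cons t s : word (t :: s) = g t * word s.
Proof. exact: big_cons. Qed.

Lemma word_nil : word [::] = 1.
Proof. exact: big_nil. Qed.

Lemma word_cat s1 s2 : word (s1 ++ s2) = word s1 * word s2.
Proof. exact: big_cat. Qed.

(** Stated for an arbitrary [x] so as to serve for the generators themselves,
    for [kappa], and later for nonzero modes of the Fock space. *)
Lemma skew_word (x : endo V) : (forall t, x * g t = - (g t * x)) ->
  forall s, x * word s = (-1) ^+ size s *: (word s * x).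
Proof.
move=> xg; elim=> [|t s IH]; first by rewrite word_nil mulr1 mul1r scale1r.
rewrite word_cons [LHS]mulrA xg mulNr -[in LHS]mulrA IH endo_mulZ [in LHS]mulrA.
by rewrite exprS mulN1r scaleNr.
Qed.

Lemma word_swap s1 s2 :
  word s1 * word s2 = (-1) ^+ (size s1 * size s2) *: (word s2 * word s1).
Proof.
elim: s1 => [|t s1 IH]; first by rewrite word_nil mulr1 mul1r scale1r.
rewrite word_cons -[LHS]mulrA IH endo_mulZ [in LHS]mulrA (skew_word (g_anticomm t)).
by rewrite endo_Zmul scalerA -exprD addnC mulrA.
Qed.

Lemma word_perm s1 s2 : perm_eq s1 s2 ->
  exists n, word s1 = (-1) ^+ n *: word s2.
Proof.
move=> s12; rewrite perm_sym in s12.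
pose sign_of s := exists n, word s = (-1) ^+ n *: word s2.
apply: (catCA_perm_ind (P := sign_of)) s12 _.
  move=> r1 r2 r3 [n E]; exists (size r2 * size r1 + n)%N.
  rewrite !word_cat mulrA (word_swap r2 r1) endo_Zmul -mulrA -!word_cat E.
  by rewrite scalerA exprD.
by exists 0%N; rewrite scale1r.
Qed.

(** Bring two equal letters next to each other, at the cost of a sign. *)
Lemma word_dup s : ~~ uniq s -> word s = 0.
Proof.
elim: s => //= t s IH; rewrite negb_and negbK word_cons => /orP[ts|/IH ->].
  have [n ->] := word_perm (perm_to_rem ts).
  by rewrite word_cons endo_mulZ mulrA g_sqr mul0r scaler0.
by rewrite mulr0.
Qed.

Variable L : seq T.
Hypothesis L_enum : perm_eq L (enum T).

Let L_uniq : uniq L.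
Proof. by rewrite (perm_uniq L_enum) enum_uniq. Qed.

Let mem_L t : t \in L.
Proof. by rewrite (perm_mem L_enum) mem_enum. Qed.

Definition monomial (p : {set T} * bool) : endo V :=
  word [seq t <- L | t \in p.1] * kappa ^+ p.2.

Definition monomial_comb (x : endo V) :=
  exists c : {set T} * bool -> K, x = \sum_p c p *: monomial p.

Lemma monomial_comb_mono p : monomial_comb (monomial p).
Proof.
exists (fun q => (q == p)%:R); rewrite (bigD1 p) //= eqxx scale1r big1 ?addr0 //.
by move=> q /negPf ->; rewrite scale0r.
Qed.

Lemma monomial_comb_lin a x y :
  monomial_comb x -> monomial_comb y -> monomial_comb (a *: x + y).
Proof.
move=> [c ->] [c' ->]; exists (fun p => a * c p + c' p).
rewrite scaler_sumr -big_split; apply: eq_bigr => p _ /=.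
by rewrite scalerDl scalerA.
Qed.

Lemma monomial_comb0 : monomial_comb 0.
Proof. by exists (fun=> 0); rewrite big1 // => p _; rewrite scale0r. Qed.

Lemma monomial_combZ a x : monomial_comb x -> monomial_comb (a *: x).
Proof.
by move=> cx; rewrite -[a *: x]addr0; apply: monomial_comb_lin (monomial_comb0).
Qed.

(** A word with a repeated letter is 0; any other one is, up to sign, the
    monomial of its set of letters. *)
Lemma word_comb s (l : bool) : monomial_comb (word s * kappa ^+ l).
Proof.
have [us|/word_dup ->] := boolP (uniq s); last first.
  by rewrite mul0r; apply: monomial_comb0.
have /word_perm[n ->] : perm_eq s [seq t <- L | t \in [set t in s]].
  apply: uniq_perm => //; first exact: filter_uniq.
  by move=> t; rewrite mem_filter mem_L andbT inE.
rewrite endo_Zmul; apply: monomial_combZ.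
exact: (monomial_comb_mono (_, _)).
Qed.

Lemma kappa_word s : kappa * word s = (-1) ^+ size s *: (word s * kappa).
Proof. exact: skew_word. Qed.

Lemma kappaX_word (l : bool) s :
  kappa ^+ l * word s = (-1) ^+ (l * size s) *: (word s * kappa ^+ l).
Proof.
case: l; last by rewrite !expr0 mul1r mulr1 scale1r.
by rewrite expr1 kappa_word -[X in _ ^+ X *: _]mul1n.
Qed.

Lemma kappaX_add (l m : bool) : kappa ^+ l * kappa ^+ m = kappa ^+ (l (+) m).
Proof. by case: l m => [] []; rewrite ?expr1 ?expr0 ?mulr1 ?mul1r. Qed.

Lemma word_mul s1 (l1 : bool) s2 (l2 : bool) :
  word s1 * kappa ^+ l1 * (word s2 * kappa ^+ l2) =
  (-1) ^+ (l1 * size s2) *: (word (s1 ++ s2) * kappa ^+ (l1 (+) l2)).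
Proof.
rewrite mulrA -[_ * _ * word s2]mulrA kappaX_word endo_mulZ endo_Zmul.
by rewrite mulrA -word_cat -mulrA kappaX_add.
Qed.

Lemma comb_mul_word x s (l : bool) :
  monomial_comb x -> monomial_comb (x * (word s * kappa ^+ l)).
Proof.
move=> [c ->]; rewrite mulr_suml.
apply: (big_ind monomial_comb) => [||p _]; first exact: monomial_comb0.
  by move=> y z cy cz; rewrite -[y]scale1r; apply: monomial_comb_lin.
rewrite endo_Zmul /monomial word_mul; do 2!apply: monomial_combZ.
exact: word_comb.
Qed.

Lemma comb_mul x y : monomial_comb x -> monomial_comb y -> monomial_comb (x * y).
Proof.
move=> cx [c ->]; rewrite mulr_sumr.
apply: (big_ind monomial_comb) => [||p _]; first exact: monomial_comb0.
  by move=> z w cz cw; rewrite -[z]scale1r; apply: monomial_comb_lin.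
by rewrite endo_mulZ; apply: monomial_combZ; apply: comb_mul_word.
Qed.

Lemma gen_subalg_comb (G : endo V -> Prop) :
  (forall x, G x -> (exists t, x = g t) \/ x = kappa) ->
  forall x, gen_subalg G x -> monomial_comb x.
Proof.
move=> GG x; elim=> {x} [x /GG[[t]|] ->||a x y _ cx _ cy|x y _ cx _ cy].
- rewrite -[g t]mulr1 -[1](expr0 kappa) -[g t]mulr1 -word_nil -word_cons.
  exact: (word_comb _ false).
- by rewrite -[kappa]mul1r -word_nil; apply: (word_comb _ true).
- by rewrite -[1]mul1r -{1}word_nil; apply: (word_comb _ false).
- exact: monomial_comb_lin.
- exact: comb_mul.
Qed.

(** A form on monomials with the values that the theorem prescribes, up to
    scalars.  Its values are assumed on all words, ordered or not and possibly
    with repetitions, so that products of monomials need not be normalized. *)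
Section Trace.
Variable Psi : {scalar (endo V)}.
Hypothesis Psi_word : forall s, Psi (word s) = 0.
Hypothesis Psi_word_kappa : forall s,
  (Psi (word s * kappa) != 0) = perm_eq s (enum T).
Hypothesis T_even : ~~ odd #|T|.

Lemma Psi_odd_kappa s : odd (size s) -> Psi (word s * kappa) = 0.
Proof.
move=> os; apply/eqP/negbNE; rewrite Psi_word_kappa; apply/negP => /perm_size sT.
by move: T_even; rewrite cardE -sT os.
Qed.

(** Write $p_1, p_2$ for the parities of the two words.  Unless both sides
    vanish, $p_1 = p_2$ and exactly one of $\ell_1, \ell_2$ is 1.  Moving
    powers of [kappa] to the right gives the signs $\ell_1 p_2$ and $\ell_2 p_1$,
    and exchanging the words gives $p_1 p_2$; these three exponents have even
    sum. *)
Lemma Psi_words_sym s1 (l1 : bool) s2 (l2 : bool) :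
  Psi (word s1 * kappa ^+ l1 * (word s2 * kappa ^+ l2)) =
  Psi (word s2 * kappa ^+ l2 * (word s1 * kappa ^+ l1)).
Proof.
rewrite !word_mul !linearZ /= [l2 (+) l1]addbC.
case l12: (l1 (+) l2); last by rewrite !expr0 !mulr1 !Psi_word !mulr0.
rewrite expr1; have [os|es] := boolP (odd (size (s1 ++ s2))).
  rewrite !Psi_odd_kappa ?mulr0 //.
  by rewrite size_cat addnC -size_cat.
rewrite [in RHS]word_cat (word_swap s2 s1) -word_cat endo_Zmul linearZ /=.
rewrite mulrA -exprD.
congr (_ * _); rewrite -signr_odd -[RHS]signr_odd; congr (_ ^+ _).
move: es l12; rewrite size_cat !oddD !oddM !oddb.
by case: (odd (size s1)); case: (odd (size s2)); case: l1; case: l2.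
Qed.

Lemma Psi_sym x y :
  monomial_comb x -> monomial_comb y -> Psi (x * y) = Psi (y * x).
Proof.
move=> [c ->] [c' ->]; rewrite mulr_suml mulr_sumr !linear_sum.
apply: eq_bigr => p _; rewrite mulr_sumr mulr_suml !linear_sum.
apply: eq_bigr => q _; rewrite !endo_mulZ !endo_Zmul !linearZ /=.
by rewrite (Psi_words_sym _ p.2) mulrCA.
Qed.

(** The monomials and their complements are dual bases up to nonzero scalars:
    the concatenated word contains every letter once only if the second set
    of letters is the complement of the first one. *)
Lemma Psi_gram p q :
  (Psi (monomial p * monomial (~: q.1, ~~ q.2)) != 0) = (p == q).
Proof.
case: p q => [A l] [B m]; rewrite /monomial word_mul linearZ /= xpair_eqE.
rewrite mulf_eq0 signr_eq0 /=.
case lm: (l (+) ~~ m); last first.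
  rewrite expr0 mulr1 Psi_word eqxx.
  by case: l m lm => [] []; rewrite ?andbF.
have -> : l == m by case: l m lm => [] [].
rewrite expr1 Psi_word_kappa andbT.
set a := [seq t <- L | t \in A]; set b := [seq t <- L | t \in ~: B].
have mem_ab t : (t \in a ++ b) = (t \in A) || (t \notin B).
  by rewrite mem_cat !mem_filter mem_L !andbT inE.
apply/idP/eqP => [ab|AB].
  have : uniq (a ++ b) by rewrite (perm_uniq ab) enum_uniq.
  rewrite cat_uniq => /and3P[_ /hasPn disj _].
  apply/setP => t; have := perm_mem ab t; rewrite mem_ab mem_enum inE.
  have := disj t; rewrite !mem_filter mem_L !andbT inE.
  by case: (t \in A); case: (t \in B) => // /(_ isT).
rewrite uniq_perm ?enum_uniq // => [|t]; last by rewrite mem_ab mem_enum AB orbN.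
rewrite cat_uniq !filter_uniq //= andbT; apply/hasPn => t.
by rewrite !mem_filter AB inE => /andP[/negPf ->].
Qed.

Lemma Psi_nondegenerate x : monomial_comb x ->
  (forall p, Psi (x * monomial p) = 0) -> x = 0.
Proof.
move=> [c ->] x0; apply: big1 => q _.
have := x0 (~: q.1, ~~ q.2); rewrite mulr_suml linear_sum (bigD1 q) //= big1 ?addr0.
  rewrite endo_Zmul linearZ => /eqP; rewrite mulf_eq0 => /orP[/eqP ->|].
    by rewrite scale0r.
  by move/negP: (Psi_gram q q); rewrite eqxx.
move=> p pq; rewrite endo_Zmul linearZ /=.
have /eqP -> : Psi (monomial p * monomial (~: q.1, ~~ q.2)) == 0.
  by rewrite -[_ == 0]negbK Psi_gram pq.
by rewrite mulr0.
Qed.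

Lemma Psi_monomial p :
  Psi (monomial p) = (p == (setT, true))%:R * Psi (word L * kappa).
Proof.
case: p => [A []]; rewrite /monomial /= xpair_eqE; last first.
  by rewrite expr0 mulr1 Psi_word andbF mul0r.
rewrite expr1 andbT; have [->|AT] := eqVneq A setT.
  rewrite mul1r; congr (Psi (word _ * _)).
  by apply/all_filterP/allP => t; rewrite inE.
rewrite mul0r; apply/eqP; rewrite -[_ == 0]negbK Psi_word_kappa.
apply: contraNN AT => /perm_mem At; apply/eqP/setP => t.
by have := At t; rewrite mem_filter mem_L mem_enum !inE !andbT.
Qed.

End Trace.
End GrassmannParity.

(** * A symplectic basis and the coefficient of the top zero mode *)

Section SymplecticFock.
Variables (K : fieldType) (h : vectType K) (form : {skew_symmetric h}) (d : nat).
Variables (phi psi : 'I_d -> h).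
Hypothesis h_basis : basis_of {:h}
  ([seq phi i | i <- enum 'I_d] ++ [seq psi i | i <- enum 'I_d]).
Hypothesis form_phi_phi : forall i j, form (phi i) (phi j) = 0.
Hypothesis form_psi_psi : forall i j, form (psi i) (psi j) = 0.
Hypothesis form_phi_psi : forall i j, form (phi i) (psi j) = - (i == j)%:R.
Hypothesis form_psi_phi : forall i j, form (psi j) (phi i) = (i == j)%:R.

Local Notation T := (bool * 'I_d)%type.

Definition symp_vec (t : T) : h := if t.1 then psi t.2 else phi t.2.

(** The coordinates are read off by pairing with the dual basis of the form,
    [(psi, - phi)]. *)
Definition symp_coord (t : T) (x : h) : K :=
  if t.1 then - form (phi t.2) x else form (psi t.2) x.

Lemma symp_coord_linear t a x y :
  symp_coord t (a *: x + y) = a * symp_coord t x + symp_coord t y.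
Proof.
rewrite /symp_coord; case: t.1; rewrite linearPr /=; last by [].
by rewrite opprD mulrN.
Qed.

Lemma symp_coord_vec t u : symp_coord t (symp_vec u) = (t == u)%:R.
Proof.
case: t u => [[] i] [[] j]; rewrite xpair_eqE /symp_coord /symp_vec /=.
- by rewrite form_phi_psi opprK.
- by rewrite form_phi_phi oppr0.
- by rewrite form_psi_psi.
- by rewrite form_psi_phi eq_sym.
Qed.

Lemma symp_expansion x : x = \sum_t symp_coord t x *: symp_vec t.
Proof.
pose p (y : h) := \sum_t symp_coord t y *: symp_vec t.
have p_lin : linear p.
  move=> a y z; rewrite /p scaler_sumr -big_split; apply: eq_bigr => t _ /=.
  by rewrite symp_coord_linear scalerDl scalerA.
have p_vec u : p (symp_vec u) = symp_vec u.
  rewrite /p (bigD1 u) //= symp_coord_vec eqxx scale1r big1 ?addr0 // => t tu.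
  by rewrite symp_coord_vec (negPf tu) scale0r.
pose pL := GRing.isLinear.Build K _ _ _ p p_lin.
pose pl := HB.pack_for {linear h -> h} p pL.
rewrite -[RHS]/(pl x).
pose X := in_tuple ([seq phi i | i <- enum 'I_d] ++ [seq psi i | i <- enum 'I_d]).
have /(@coord_span _ _ _ X) -> : x \in <<X>>%VS.
  by rewrite (span_basis h_basis) memvf.
rewrite linear_sum; apply: eq_bigr => i _; rewrite linearZ; congr (_ *: _).
have [t ->] : exists t, X`_i = symp_vec t; last exact/esym/p_vec.
have : X`_i \in tval X by apply: mem_nth.
rewrite mem_cat => /orP[] /mapP[j _ ->]; first by exists (false, j).
by exists (true, j).
Qed.

Lemma form_expansion x y :
  form x y = \sum_t form x (symp_vec t) * symp_coord t y.
Proof.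
rewrite {1}[y]symp_expansion linear_sumr; apply: eq_bigr => t _.
by rewrite linearZr_LR /= mulrC.
Qed.

(** The position in the bit strings that the modes of levels [n] and [- n]
    along [t] share, one annihilating and the other creating. *)
Definition fermi_code (t : T) (n : nat) : nat := choice.pickle (t, n).

Lemma fermi_code_eq t u m n :
  (fermi_code t m == fermi_code u n) = (t == u) && (m == n).
Proof. by rewrite (inj_eq (pcan_inj choice.pickleK)) xpair_eqE. Qed.

Definition fermi_coef (x : h) (n : int) (t : T) : K :=
  if 0 < n then n%:~R * form x (symp_vec t) else symp_coord t x.

(** Modes with [n <= 0] create, modes with [n > 0] annihilate; the factor [n]
    and the form are put on the annihilators, so that creators may stay
    independent of the form. *)
Definition fermi_mode (x : h) (n : int) : endo (bit_space K) :=
  \sum_t fermi_coef x n t *: jw K (n <= 0) (fermi_code t `|n|).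

Lemma fermi_mode_linear a x y n :
  fermi_mode (a *: x + y) n = a *: fermi_mode x n + fermi_mode y n.
Proof.
rewrite /fermi_mode scaler_sumr -big_split; apply: eq_bigr => t _ /=.
rewrite scalerA -scalerDl; congr (_ *: _); rewrite /fermi_coef; case: ifP => _.
  by rewrite linearPl /= mulrDr mulrCA.
exact: symp_coord_linear.
Qed.

(** By the anticommutation relations only the terms with equal basis vectors and
    opposite nonzero levels survive; their sum is the expansion of the form.
    When [m] is negative the roles of [x] and [y] are exchanged, which
    skew-symmetry of the form compensates. *)
Lemma fermi_mode_anticommutator x y m n :
  fermi_mode x m * fermi_mode y n + fermi_mode y n * fermi_mode x m =
  (m%:~R * form x y * (m + n == 0)%:R) *: (1 : endo (bit_space K)).
Proof.
transitivity ((\sum_t fermi_coef x m t * fermi_coef y n t *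
    ((`|m| == `|n|)%N && ((m <= 0) != (n <= 0)))%:R) *: (1 : endo (bit_space K))).
  rewrite /fermi_mode mulr_suml mulr_sumr -big_split scaler_suml.
  apply: eq_bigr => t _ /=; rewrite mulr_sumr mulr_suml -big_split /= (bigD1 t) //=.
  rewrite big1 ?addr0 => [|u ut];
    rewrite !endo_mulZ !endo_Zmul !scalerA [X in _ + X *: _]mulrC -scalerDr;
    rewrite jw_anticommutator scalerA.
    by rewrite fermi_code_eq eqxx andTb [fermi_coef y n t * _]mulrC.
  by rewrite fermi_code_eq eq_sym (negPf ut) mulr0 scale0r.
congr (_ *: _); rewrite -mulr_suml.
case: (ltrP 0 m) => m0; case: (ltrP 0 n) => n0.
- by rewrite andbF (gt_eqF (addr_gt0 m0 n0)) !mulr0.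
- have -> : (`|m| == `|n|)%N = (m + n == 0) by lia.
  rewrite andbT; case: eqVneq => [mn|_]; last by rewrite !mulr0.
  rewrite !mulr1 form_expansion mulr_sumr; apply: eq_bigr => t _.
  by rewrite /fermi_coef m0 ltNge n0 mulrA.
- have -> : (`|m| == `|n|)%N = (m + n == 0) by lia.
  rewrite andbT; case: eqVneq => [mn|_]; last by rewrite !mulr0.
  have -> : m = - n by lia.
  rewrite !mulr1 hermC /= expr1 mulN1r mulrN rmorphN mulNr opprK.
  rewrite form_expansion mulr_sumr; apply: eq_bigr => t _.
  by rewrite /fermi_coef n0 oppr_gt0 lt_gtF // mulrC mulrA.
- rewrite andbF mulr0; case: eqVneq => [mn|_]; last by rewrite mulr0.
  have -> : m = 0 by lia.
  by rewrite mulr0z !mul0r.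
Qed.

Lemma fermi_mode_pos x n : 0 < n -> fermi_mode x n (jw_vacuum K) = 0.
Proof.
move=> n_gt0; rewrite /fermi_mode leNgt n_gt0 /=.
apply: (big_ind (fun f : endo _ => f (jw_vacuum K) = 0)) => // [f g f0 g0|t _].
  by rewrite endoDE f0 g0 addr0.
by rewrite endoZE jw_annihilates_vacuum scaler0.
Qed.

Lemma fermi_mode_zero t : fermi_mode (symp_vec t) 0 = jw K true (fermi_code t 0).
Proof.
rewrite /fermi_mode (bigD1 t) //= big1 ?addr0.
  by rewrite /fermi_coef ltxx symp_coord_vec eqxx scale1r.
by move=> u ut; rewrite /fermi_coef ltxx symp_coord_vec (negPf ut) scale0r.
Qed.

Definition zero_mode (t : T) : endo (fock form) :=
  fock_act (sf_mode form (symp_vec t) 0).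

(** The functional is evaluation at the state where all the zero modes and
    no other modes are occupied, after mapping to the bit space. *)
Lemma fock_top_coefficient_ex : exists lambda : {scalar fock form},
  forall s : seq T, (lambda (word zero_mode s (vacuum form)) != 0) =
    perm_eq s (enum (T : finType)).
Proof.
have [pi [pi_vac pi_mode]] :=
  fock_map_ex fermi_mode_linear fermi_mode_anticommutator fermi_mode_pos.
pose L := [seq fermi_code t 0%N | t : T].
pose l (v : fock form) : K := pi v (fun k => k \in L).
have l_lin : linear_for *%R l by move=> a u v; rewrite /l linearP.
pose lL := GRing.isLinear.Build K _ _ _ l l_lin.
exists (HB.pack_for {scalar fock form} l lL) => s /=.
have code_inj : injective (fermi_code^~ 0%N).
  by move=> t u /eqP; rewrite fermi_code_eq eqxx andbT => /eqP.
have -> : perm_eq s (enum (T : finType)) = perm_eq (map (fermi_code^~ 0%N) s) L.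
  by apply/idP/idP => [|/(perm_map_inj code_inj)] //; apply: perm_map.
rewrite -(jw_top_coefficient K); last first.
  by rewrite map_inj_uniq ?enum_uniq.
suff <- : pi (word zero_mode s (vacuum form)) =
    (\prod_(j <- map (fermi_code^~ 0%N) s) jw K true j) (jw_vacuum K) by [].
rewrite big_map; elim: s => [|t s IH]; first by rewrite word_nil big_nil !endo1E.
by rewrite word_cons big_cons !endoME pi_mode fermi_mode_zero IH.
Qed.

(** * The trace form on the endomorphisms of the Fock space *)

Local Notation E := (endo (fock form)).
Local Notation mode x n := (fock_act (sf_mode form x n) : E).
Local Notation kappa := (parity_operator form).
Local Notation vac := (vacuum form).

Lemma mode_anticommutator x y m n : mode x m * mode y n + mode y n * mode x m =
  (m%:~R * form x y * (m + n == 0)%:R) *: (1 : E).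
Proof.
apply/endoP => v; rewrite -!fock_actM endoDE -fock_actD sf_mode_anticommutator.
by rewrite fock_actZ fock_act1.
Qed.

Lemma mode_zero_skew x y n : mode x n * mode y 0 = - (mode y 0 * mode x n).
Proof.
apply/eqP; rewrite -addr_eq0 addrC mode_anticommutator.
by rewrite mulr0z !mul0r scale0r.
Qed.

Lemma zero_mode_sqr t : (2%:R : K) != 0 -> zero_mode t * zero_mode t = 0.
Proof.
move=> two; have /eqP := mode_zero_skew (symp_vec t) (symp_vec t) 0.
rewrite -addr_eq0 => /eqP gg; apply: (scalerI two).
by rewrite scaler0 scaler_nat mulr2n -/(zero_mode t) gg.
Qed.

Lemma kappa_fock_word s :
  kappa (fock_word form s) = (-1) ^+ size s *: fock_word form s.
Proof.
have [even_id odd_opp] := parity_operatorP form.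
rewrite -signr_odd; case s_odd: (odd (size s)).
  by rewrite odd_opp ?scaleN1r //; apply: span_incl; exists s.
by rewrite even_id ?scale1r //; apply: span_incl; exists s.
Qed.

(** Checked on the spanning vectors, whose length the mode increases by one. *)
Lemma kappa_mode x (n : nat) :
  kappa * mode x (- n%:Z) = - (mode x (- n%:Z) * kappa).
Proof.
apply/endoP => v; rewrite endoNE !endoME.
elim: (fock_spanned v) => [_ [s ->]||a u w _ IHu _ IHw].
- rewrite -fock_word_cons !kappa_fock_word linearZ fock_word_cons /= exprS mulN1r.
  by rewrite scaleNr.
- by rewrite !linear0 ?oppr0.
- by rewrite !linearP IHu IHw.
Qed.

Lemma kappa_zero_mode t : kappa * zero_mode t = - (zero_mode t * kappa).
Proof. by have := kappa_mode (symp_vec t) 0; rewrite oppr0. Qed.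

Lemma kappa_vacuum : kappa vac = vac.
Proof. by rewrite -fock_word_nil kappa_fock_word scale1r. Qed.

Lemma kappa_sqr : kappa * kappa = 1.
Proof.
apply/endoP => v; rewrite endoME endo1E.
elim: (fock_spanned v) => [_ [s ->]||a u w _ IHu _ IHw].
- rewrite kappa_fock_word linearZ /= kappa_fock_word scalerA.
  by rewrite -signr_odd -expr2 sqrr_sign scale1r.
- by rewrite !linear0.
- by rewrite !linearP IHu IHw.
Qed.

(** In the proof, [C] creates an odd vector and [D] undoes it.  Passing [D]
    through a word of length [r] yields $(-1)^r$, which can be dropped because
    the top coefficient is nonzero only for words of length $2d$; so the two
    terms of the form agree on words, and [kappa (C vac) = - C vac] makes
    them opposite on words times [kappa]. *)
Lemma trace_form_ex (i0 : 'I_d) : (2%:R : K) != 0 ->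
  exists Psi : {scalar E},
    (forall s, Psi (word zero_mode s) = 0) /\
    (forall s, (Psi (word zero_mode s * kappa) != 0) =
       perm_eq s (enum (T : finType))).
Proof.
move=> two; have [lambda lambdaP] := fock_top_coefficient_ex.
pose C := mode (phi i0) (- 1%N%:Z); pose D := mode (psi i0) 1.
have D0 : D vac = 0 by apply: fock_act_vacuum.
have DC : D (C vac) = vac.
  rewrite -[D (C vac)]/((D * C) vac).
  have := mode_anticommutator (psi i0) (phi i0) 1 (- 1%N%:Z).
  rewrite form_psi_phi eqxx !mulr1 scale1r -/C -/D => /endoP/(_ vac).
  by rewrite endoDE !endoME D0 linear0 addr0.
have D_word s :
    D (word zero_mode s (C vac)) = (-1) ^+ size s *: word zero_mode s vac.
  have Dg t : D * zero_mode t = - (zero_mode t * D) by apply: mode_zero_skew.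
  by rewrite -endoME (skew_word Dg) endoZE endoME DC.
have lambda_odd s : lambda ((-1) ^+ size s *: word zero_mode s vac) =
    lambda (word zero_mode s vac).
  case: (eqVneq (lambda (word zero_mode s vac)) 0) => [l0|].
    by rewrite linearZ /= l0 mulr0.
  rewrite lambdaP => /perm_size ->; rewrite -cardE card_prod card_bool card_ord.
  by rewrite -signr_odd oddM /= expr0 scale1r.
pose P (x : E) : K := lambda (x vac) - lambda (D (x (C vac))).
have P_lin : linear_for *%R P.
  by move=> a x y; rewrite /P !linearP /= mulrBr opprD addrACA.
pose PL := GRing.isLinear.Build K _ _ _ P P_lin.
exists (HB.pack_for {scalar E} P PL); split=> s /=; rewrite /P.
  by rewrite D_word lambda_odd subrr.
have kC : kappa (C vac) = - C vac.
  by rewrite -endoME kappa_mode endoNE endoME kappa_vacuum.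
rewrite !endoME kC kappa_vacuum !linearN /= opprK D_word lambda_odd.
by rewrite -mulr2n -mulr_natr mulf_eq0 negb_or two andbT lambdaP.
Qed.

End SymplecticFock.

(** * The symmetrizing form *)

Section OperatorAlgebraForm.
Variables (K : fieldType) (h : vectType K) (form : {skew_symmetric h}) (d : nat).
Variables (phi psi : 'I_d -> h).
Hypothesis two_neq0 : (2%:R : K) != 0.
Hypothesis d_gt0 : (0 < d)%N.
Hypothesis h_basis : basis_of {:h}
  ([seq phi i | i <- enum 'I_d] ++ [seq psi i | i <- enum 'I_d]).
Hypothesis form_phi_phi : forall i j, form (phi i) (phi j) = 0.
Hypothesis form_psi_psi : forall i j, form (psi i) (psi j) = 0.
Hypothesis form_phi_psi : forall i j, form (phi i) (psi j) = - (i == j)%:R.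
Hypothesis form_psi_phi : forall i j, form (psi j) (phi i) = (i == j)%:R.

Local Notation T := (bool * 'I_d)%type.
Local Notation P := (op_algebra form phi psi).
Local Notation E := (endo (fock form)).
Local Notation g := (zero_mode form phi psi).
Local Notation kappa := (parity_operator form).
Local Notation Om := (Omega form phi psi).

(** The order $e_1, f_1, e_2, f_2, \dots$ of the factors of [Omega]. *)
Definition mode_list : seq T :=
  [seq (b, i) | i <- index_enum 'I_d, b <- [:: false; true]].

Lemma mode_list_enum : perm_eq mode_list (enum (T : finType)).
Proof.
apply: uniq_perm; rewrite ?enum_uniq //.
  apply: allpairs_uniq => //; first exact: index_enum_uniq.
  by move=> [i b] [j c] _ _ /= [-> ->].
move=> [b i]; rewrite mem_enum inE; apply/allpairsP; exists (i, b).
by rewrite mem_index_enum; split=> //; case: b.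
Qed.

Definition occupied (m n : 'I_d -> bool) : {set T} :=
  [set t | if t.1 then n t.2 else m t.2].

Definition op_val (x : P) : E := val x.

Lemma op_val_Omega m n l :
  op_val (Om m n l) = monomial g kappa mode_list (occupied m n, l).
Proof.
rewrite /op_val /Omega /monomial rmorphM rmorph_prod rmorphXn; congr (_ * _).
rewrite /word big_filter [RHS]big_mkcond big_allpairs_dep; apply: eq_bigr => i _.
transitivity ((if m i then g (false, i) else 1)
    * (if n i then g (true, i) else 1)).
  by rewrite rmorphM !rmorphXn /=; case: (m i) (n i) => [] [].
by rewrite !big_cons big_nil /= mulr1 !inE.
Qed.

Lemma op_val_comb (x : P) : monomial_comb g kappa mode_list (op_val x).
Proof.
case: x => x xP; rewrite /op_val /=; move/gen_subalg_predP: xP.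
apply: gen_subalg_comb.
- by move=> t; apply: zero_mode_sqr.
- by move=> t u; apply: mode_zero_skew.
- by move=> t; apply: kappa_zero_mode.
- exact: kappa_sqr.
- exact: mode_list_enum.
- move=> f [i|i|]; last by right.
    by left; exists (false, i).
  by left; exists (true, i).
Qed.

Definition set_Omega (p : {set T} * bool) : P :=
  Om (fun i => (false, i) \in p.1) (fun i => (true, i) \in p.1) p.2.

Lemma op_val_set_Omega p : op_val (set_Omega p) = monomial g kappa mode_list p.
Proof.
rewrite op_val_Omega; case: p => A l /=; congr (monomial _ _ _ (_, _)).
by apply/setP => -[[] i]; rewrite inE.
Qed.

Lemma Omega_comb (x : P) :
  exists c : {set T} * bool -> K, x = \sum_p c p *: set_Omega p.
Proof.
have [c xE] := op_val_comb x; exists c; apply: val_inj.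
rewrite [LHS]xE linear_sum; apply: eq_bigr => p _.
by rewrite linearZ -[X in _ = _ *: X]/(op_val _) op_val_set_Omega.
Qed.

Lemma occupied_full m n l :
  ((occupied m n, l) == (setT, true))%:R =
  (l == 1%N :> nat)%:R *
  \prod_(i < d) ((m i == 1%N :> nat)%:R * (n i == 1%N :> nat)%:R) :> K.
Proof.
have b1 (b : bool) : (b == 1%N :> nat) = b by case: b.
rewrite xpair_eqE b1 andbC eqb_id -mulnb natrM; congr (_ * _).
under eq_bigr => i _ do rewrite !b1.
have [full|] := eqVneq (occupied m n) setT.
  rewrite big1 // => i _.
  have := in_setT (false, i); have := in_setT (true, i).
  by rewrite -full !inE /= => -> ->; rewrite mulr1.
rewrite -subTset => /subsetPn[[b i] _]; rewrite inE (bigD1 i) //=.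
by case: b => /negPf /= ->; rewrite !(mulr0, mul0r).
Qed.

(** The form of [trace_form_ex], divided by its value on
    $e_1 f_1 \cdots e_d f_d K$. *)
Lemma symmetrizing_form_ex :
  let on_Omega (vphi : {scalar P}) := forall m n l,
      vphi (Om m n l) = (l == 1%N :> nat)%:R *
        \prod_(i < d) ((m i == 1%N :> nat)%:R * (n i == 1%N :> nat)%:R) in
  exists vphi : {scalar P},
    [/\ on_Omega vphi,
        (forall vphi' : {scalar P}, on_Omega vphi' -> vphi' =1 vphi),
        (forall x y : P, vphi (x * y) = vphi (y * x)),
        (forall x : P, (forall y : P, vphi (x * y) = 0) -> x = 0) &
        (forall y : P, (forall x : P, vphi (x * y) = 0) -> y = 0)].
Proof.
move=> on_Omega.
have g_sqr t : g t * g t = 0 by apply: zero_mode_sqr.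
have g_skew t u : g t * g u = - (g u * g t) by apply: mode_zero_skew.
have kappa_g t : kappa * g t = - (g t * kappa) by apply: kappa_zero_mode.
have T_even : ~~ odd #|{: T}| by rewrite card_prod card_bool card_ord oddM.
have [Psi [Psi_word Psi_word_kappa]] :=
  trace_form_ex h_basis form_phi_phi form_psi_psi form_phi_psi form_psi_phi
    (Ordinal d_gt0) two_neq0.
have PsiE := Psi_monomial mode_list_enum Psi_word Psi_word_kappa.
set top := Psi (word g mode_list * kappa) in PsiE.
have top_neq0 : top != 0 by rewrite Psi_word_kappa mode_list_enum.
pose v (x : P) : K := top^-1 * Psi (op_val x).
have v_lin : linear_for *%R v.
  by move=> a x y; rewrite /v /op_val !linearP /= mulrDr mulrCA.
pose vL := GRing.isLinear.Build K _ _ _ v v_lin.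
pose vphi := HB.pack_for {scalar P} v vL.
have vphiM x y : vphi (x * y) = top^-1 * Psi (op_val x * op_val y).
  by rewrite /= /v /op_val rmorphM.
have vphi_Omega : on_Omega vphi.
  move=> m n l; rewrite /= /v op_val_Omega PsiE mulrCA mulVf // mulr1.
  exact: occupied_full.
have vphi_sym x y : vphi (x * y) = vphi (y * x).
  rewrite !vphiM; congr (_ * _).
  exact: (Psi_sym g_skew kappa_g (kappa_sqr form) Psi_word Psi_word_kappa T_even
    (op_val_comb x) (op_val_comb y)).
have vphi_nondeg (x : P) : (forall y, vphi (x * y) = 0) -> x = 0.
  move=> x0; apply: val_inj; rewrite -[LHS]/(op_val x) raddf0.
  apply: (Psi_nondegenerate kappa_g (kappa_sqr form) mode_list_enum
    Psi_word Psi_word_kappa (op_val_comb x)) => p.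
  rewrite -op_val_set_Omega; have /eqP := x0 (set_Omega p).
  rewrite vphiM mulf_eq0 invr_eq0 (negPf top_neq0).
  by move/eqP.
exists vphi; split=> //.
  move=> w w_Omega x; have [c ->] := Omega_comb x.
  rewrite !linear_sum; apply: eq_bigr => p _.
  by rewrite !linearZ w_Omega vphi_Omega.
by move=> y y0; apply: vphi_nondeg => x; rewrite vphi_sym.
Qed.
End OperatorAlgebraForm.

Theorem proposition6p1p2 (R : realType) (d : nat) (h : vectType R[i])
    (form : {skew_symmetric h}) (phi psi : 'I_d -> h)
    (d_ge1 : (1 <= d)%N)
    (dim_h : \dim {:h} = (2 * d)%N)
    (form_nondeg : nondegenerate form)
    (h_basis : basis_of {:h}
       ([seq phi i | i <- enum 'I_d] ++ [seq psi i | i <- enum 'I_d]))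
    (form_phi_phi : forall i j : 'I_d, form (phi i) (phi j) = 0)
    (form_psi_psi : forall i j : 'I_d, form (psi i) (psi j) = 0)
    (form_phi_psi : forall i j : 'I_d, form (phi i) (psi j) = - (i == j)%:R)
    (form_psi_phi : forall i j : 'I_d, form (psi j) (phi i) = (i == j)%:R) :
  let P := op_algebra form phi psi in
  let on_Omega (vphi : {scalar P}) :=
    forall (m n : 'I_d -> bool) (l : bool),
      vphi (Omega form phi psi m n l) =
        (l == 1%N :> nat)%:R *
        \prod_(i < d) ((m i == 1%N :> nat)%:R * (n i == 1%N :> nat)%:R) in
  exists vphi : {scalar P},
    [/\ on_Omega vphi,
        (forall vphi' : {scalar P}, on_Omega vphi' -> vphi' =1 vphi),
        (forall x y : P, vphi (x * y) = vphi (y * x)),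
        (forall x : P, (forall y : P, vphi (x * y) = 0) -> x = 0) &
        (forall y : P, (forall x : P, vphi (x * y) = 0) -> y = 0)].
Proof.
have two_neq0 : (2%:R : R[i]) != 0 by rewrite pnatr_eq0.
exact: symmetrizing_form_ex.
Qed.
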